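(* Let $d\ge1$, $I=\{1,\dots,d\}$, let $D=\prod_{i=1}^dD_i$ with each $D_i\subset\mathbb{R}$ compact and endowed with a (Borel) probability measure $\nu_i$. Let $Z=(Z_{\mathbf{x}})_{\mathbf{x}\in D}$ be a centred Gaussian random field with covariance function $k$ and with continuous sample paths, and for $u\subseteq I$ let $Z^{(u)}=T_uZ$ (applied pathwise). Then the $2^d$-dimensional vector-valued random field $(Z^{(u)}_{\mathbf{x}},\,u\subseteq I)_{\mathbf{x}\in D}$ is Gaussian, centred, and has continuous sample paths. Its matrix-valued covariance function is given by $$\operatorname{Cov}\bigl(Z^{(u)}_{\mathbf{x}},Z^{(v)}_{\mathbf{y}}\bigr)=[T_u\otimes T_v]k\,(\mathbf{x},\mathbf{y}),\qquad u,v\subseteq I,\ \mathbf{x},\mathbf{y}\in D.$$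
   Context: For $u\subseteq I$, $\mathbf{x}_{-u}=(x_i)_{i\in I\setminus u}$ and $\nu_{-u}=\bigotimes_{j\in I\setminus u}\nu_j$; integration against $\nu_{-u'}(\mathrm{d}\mathbf{x}_{-u'})$ integrates out the coordinates $x_j$, $j\notin u'$, leaving the others fixed. $T_u$ is the linear operator on the space $C_b(D)$ of continuous functions $D\to\mathbb{R}$ given by $$(T_uf)(\mathbf{x})=\sum_{u'\subseteq u}(-1)^{|u|-|u'|}\int f(\mathbf{x})\,\nu_{-u'}(\mathrm{d}\mathbf{x}_{-u'}).$$ For the kernel $k$, $$[T_u\otimes T_v]k(\mathbf{x},\mathbf{y})=\sum_{u'\subseteq u}\sum_{v'\subseteq v}(-1)^{|u|+|v|-|u'|-|v'|}\int k(\mathbf{x},\mathbf{y})\,\nu_{-u'}(\mathrm{d}\mathbf{x}_{-u'})\,\nu_{-v'}(\mathrm{d}\mathbf{y}_{-v'}).$$ An $\mathbb{R}^p$-valued random field $(Z_{\mathbf{x}})_{\mathbf{x}\in D}$ is Gaussian if for any $n\ge1$ and $\mathbf{x}^{(1)},\dots,\mathbf{x}^{(n)}\in D$ the variables $Z^{(j)}_{\mathbf{x}^{(i)}}$, $1\le i\le n$, $1\le j\le p$, are jointly ($np$-variate) normally distributed (degenerate normal laws allowed). *)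

(* Defs.v *)
From HB Require Import structures.
From mathcomp Require Import all_boot all_order all_algebra.
From mathcomp Require Import all_classical all_reals all_analysis.

Set Implicit Arguments.
Unset Strict Implicit.
Unset Printing Implicit Defensive.

Import Order.TTheory GRing.Theory Num.Theory.
Import numFieldNormedType.Exports.

Local Open Scope classical_set_scope.
Local Open Scope ring_scope.

Definition tuple_cons (R : realType) (n : nat) (z : R * n.-tuple R) :
  n.+1.-tuple R := [tuple of z.1 :: z.2].

Lemma measurable_tuple_cons (R : realType) (n : nat) :
  measurable_fun [set: R * n.-tuple R] (@tuple_cons R n).
Proof. exact: measurable_cons. Qed.

Section prod_cons.
Context (R : realType) (n : nat).
Variables (mu : probability R R) (nu : probability (n.-tuple R) R).

Definition prod_cons : set (n.+1.-tuple R) -> \bar R :=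
  pushforward (mu \x nu)%E (@tuple_cons R n).

Let prod_cons0 : prod_cons set0 = 0%E.
Proof. by rewrite /prod_cons /pushforward preimage_set0 measure0. Qed.

Let prod_cons_ge0 A : (0 <= prod_cons A)%E.
Proof. by rewrite /prod_cons /pushforward; exact: measure_ge0. Qed.

Let prod_cons_sigma_additive : semi_sigma_additive prod_cons.
Proof.
move=> F mF tF mUF; rewrite /prod_cons /pushforward preimage_bigcup.
have mF' i : measurable (@tuple_cons R n @^-1` F i).
  by rewrite -[X in measurable X]setTI; exact: measurable_tuple_cons.
apply: (@measure_semi_sigma_additive _ _ _ (mu \x nu)%E) => //.
- apply/trivIsetP => /= i j _ _ ij; rewrite -preimage_setI.
  by move/trivIsetP : tF => /(_ _ _ _ _ ij) ->//; rewrite preimage_set0.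
- exact: bigcup_measurable.
Qed.

HB.instance Definition _ := isMeasure.Build _ _ _ prod_cons
  prod_cons0 prod_cons_ge0 prod_cons_sigma_additive.

Let prod_cons_setT : prod_cons setT = 1%E.
Proof.
rewrite /prod_cons /pushforward preimage_setT -setXTT.
transitivity (mu setT * nu setT)%E; first exact: product_measure1E.
by rewrite !probability_setT mule1.
Qed.

HB.instance Definition _ :=
  @Measure_isProbability.Build _ _ R prod_cons prod_cons_setT.

End prod_cons.

Fixpoint prod_prob (R : realType) (n : nat) :
    ('I_n -> probability R R) -> probability (n.-tuple R) R :=
  match n return ('I_n -> probability R R) -> probability (n.-tuple R) R with
  | 0 => fun=> \d_([tuple] : 0.-tuple R)
  | n'.+1 => fun nu => prod_cons (nu ord0) (prod_prob (fun i => nu (lift ord0 i)))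
  end.

(* On the sigma-algebra of n.-tuple R, generated by the coordinates, this
   determines prod_prob nu. *)
Lemma prod_prob_box (R : realType) (n : nat) (nu : 'I_n -> probability R R)
    (A : 'I_n -> set R) : (forall i, measurable (A i)) ->
  prod_prob nu [set z | forall i, A i (tnth z i)] = (\prod_(i < n) nu i (A i))%E.
Proof.
elim: n => [|n IH] in nu A * => mA.
  rewrite big_ord0 /= diracE mem_set//=; by case.
rewrite big_ord_recl /= /prod_cons /pushforward.
rewrite -IH//.
rewrite -product_measure1E//; last first.
  rewrite (_ : [set z | _] = \bigcap_(i in [set: 'I_n])
      ((@tnth n R)^~ i @^-1` A (lift ord0 i))).
    apply: fin_bigcap_measurable => // i _.
    by rewrite -[X in measurable X]setTI; exact: measurable_tnth.
  by apply/seteqP; split => z /= H i => [_|]; exact: H.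
congr (product_measure1 _ _ _); apply/seteqP; split => -[a z] /=.
  move=> H; split; first by have := H ord0; rewrite tnth0.
  by move=> i; have := H (lift ord0 i); rewrite tnthS.
move=> [Ha Hz] i; case: (unliftP ord0 i) => [j ->|->].
  by rewrite tnthS; exact: Hz.
by rewrite tnth0.
Qed.

Section coordinates.
Context (R : realType) (d : nat).
Implicit Types (D : 'I_d -> set R) (nu : 'I_d -> probability R R).
Implicit Types (u v : {set 'I_d}) (x y : 'rV[R]_d).

Definition box D : set 'rV[R]_d := [set x | forall i, D i (x 0 i)].

(* A point of \prod_(j \notin u) R is the tuple of its coordinates listed in
   the order of enum (~: u). *)
Definition box_minus D u : set (#|~: u|.-tuple R) :=
  [set z | forall k, D (enum_val k) (tnth z k)].

Definition nu_minus nu u : probability (#|~: u|.-tuple R) R :=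
  prod_prob (fun k => nu (enum_val k)).

Definition merge_coord u x (z : #|~: u|.-tuple R) : 'rV[R]_d :=
  \row_i (if i \in u then x 0 i else nth 0 z (index i (enum (~: u)))).

#[global] Arguments box_minus D u : clear implicits.
#[global] Arguments merge_coord u x z : clear implicits.

(* Functions on [box D] are represented by total functions; for x in [box D]
   the values below only depend on the restriction of f (of k) to [box D]. *)
Definition T_op D nu u (f : 'rV[R]_d -> R) x : R :=
  \sum_(u' : {set 'I_d} | u' \subset u) (-1) ^+ (#|u| - #|u'|) *
    \int[nu_minus nu u']_(z in box_minus D u') f (merge_coord u' x z).

Definition T_op2 D nu u v (k : 'rV[R]_d -> 'rV[R]_d -> R) x y : R :=
  \sum_(u' : {set 'I_d} | u' \subset u) \sum_(v' : {set 'I_d} | v' \subset v)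
    (-1) ^+ (#|u| + #|v| - #|u'| - #|v'|) *
    \int[(nu_minus nu u' \x nu_minus nu v')%E]_(w in
        box_minus D u' `*` box_minus D v')
      k (merge_coord u' x w.1) (merge_coord v' y w.2).

End coordinates.

(* [normal_prob m 0] is not a Dirac mass in the library (it is a uniform law),
   so the degenerate case is added by hand. *)
Definition normal_law (R : realType) (m s : R) : set R -> \bar R :=
  if s == 0 then \d_m else normal_prob m s.

Section gaussian.
Context (R : realType) (dT : measure_display) (T : measurableType dT).
Variable P : probability T R.

Definition normal_rv (X : T -> R) :=
  measurable_fun setT X /\
  exists m s : R, 0 <= s /\
    forall A : set R, measurable A -> pushforward P X A = normal_law m s A.

(* multivariate normality, degenerate laws allowed: every linear combination
   is univariate normal *)
Definition jointly_normal (K : finType) (X : K -> T -> R) :=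
  (forall k, measurable_fun setT (X k)) /\
  forall a : K -> R, normal_rv (fun w => \sum_k a k * X k w).

Context (U : topologicalType) (D : set U) (p : nat).
Implicit Types W : U -> T -> 'rV[R]_p.

Definition gaussian_field W :=
  forall (n : nat) (x : 'I_n -> U), (0 < n)%N -> (forall i, D (x i)) ->
    jointly_normal (fun (ij : 'I_n * 'I_p) w => W (x ij.1) w 0 ij.2).

Definition centred_field W :=
  forall x, D x -> forall j, 'E_P[fun w => W x w 0%R j]%E = 0%E.

Definition continuous_paths W :=
  forall w, {within D, continuous (fun x => W x w)}.

End gaussian.

(* Main.v *)
(** Every Z^(u)_x is a finite linear combination of integrals of Z over
    partial boxes, hence a pointwise limit of Riemann sums, that is, of finite
    linear combinations of values of Z, which are centred normal by hypothesis.

    A pointwise limit X of centred normal variables X_n of standard deviations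
    s_n is centred normal, and s_n converges to the standard deviation of X:
    E[exp(-X_n^2)] = (1 + 2 s_n^2)^(-1/2) converges to E[exp(-X^2)] > 0 by
    dominated convergence, which forces s_n to converge; passing to the limit in
    E[f(X_n)] for bounded continuous f then identifies the law of X.  Applied to
    finite linear combinations of the Z^(u)_x this gives Gaussianity.

    As second moments pass to the limit too, so do covariances, by
    polarization.  This yields first the continuity (and boundedness, D being
    compact) of k, and then the formula: the covariance of two Riemann sums is a
    Riemann sum of k, which converges to the double integral of k. *)
Require Import Defs.
From HB Require Import structures.
From mathcomp Require Import all_boot all_order all_algebra.
From mathcomp Require Import all_classical all_reals all_analysis.
From mathcomp Require Import measurable_realfun ring lra zify.

Set Implicit Arguments.
Unset Strict Implicit.
Unset Printing Implicit Defensive.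

Import Order.TTheory GRing.Theory Num.Theory.
Import numFieldNormedType.Exports.

Local Open Scope classical_set_scope.
Local Open Scope ring_scope.

(** * Normal laws as integrals *)

Section density.
Context d (T : measurableType d) (R : realType).
Variables (mu nu : {measure set T -> \bar R}) (g : T -> R).
Hypotheses (mg : measurable_fun setT g) (g0 : forall x, 0 <= g x).
Hypothesis nuE : forall A, measurable A ->
  nu A = (\int[mu]_(x in A) (g x)%:E)%E.
Local Open Scope ereal_scope.
Import HBNNSimple.

Let integral_density_nnsfun (f : {nnsfun T >-> R}) :
  \int[nu]_x (f x)%:E = \int[mu]_x ((f x)%:E * (g x)%:E).
Proof.
under [LHS]eq_integral do rewrite fimfunE -fsumEFin//.
rewrite [LHS]ge0_integral_fsum//; last 2 first.
  - by move=> r; exact/measurable_EFinP/measurableT_comp.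
  - by move=> n x _; rewrite EFinM nnfun_muleindic_ge0.
under [RHS]eq_integral.
  move=> x xD; rewrite fimfunE -fsumEFin// muleC ge0_mule_fsumr; last first.
    by move=> r; rewrite EFinM nnfun_muleindic_ge0.
  over.
rewrite [RHS]ge0_integral_fsum//; last 2 first.
  - move=> r; apply/measurable_EFinP; apply: measurable_funM => //.
    exact: measurableT_comp.
  - move=> n x _; rewrite mule_ge0 ?lee_fin//.
    by rewrite -lee_fin EFinM nnfun_muleindic_ge0.
apply: eq_fsbigr => r _.
rewrite integralZl_indic_nnsfun// integral_indic// setIT nuE//.
have [r0|r0] := leP 0%R r; last first.
  by rewrite preimage_nnfun0// integral_set0 mule0 integral0_eq// => x _;
    rewrite indicE in_set0 mulr0 mule0.
rewrite -ge0_integralZl//; last 2 first.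
  - exact/measurable_EFinP/measurable_funTS.
  - by move=> x _; rewrite lee_fin.
rewrite integral_mkcond; apply: eq_integral => x _.
rewrite patchE indicE; case: ifPn => _; rewrite ?mulr1 ?mulr0 ?mule0//.
by rewrite muleC.
Qed.

(** Monotone convergence along simple functions increasing to [f]; for a simple function the formula
    is linearity together with [nuE] on its level sets. *)
Lemma ge0_integral_density (f : T -> \bar R) :
  measurable_fun setT f -> (forall x, 0 <= f x) ->
  \int[nu]_x f x = \int[mu]_x (f x * (g x)%:E).
Proof.
move=> mf f0.
pose f_ := nnsfun_approx measurableT mf.
have cf x : (f_ n x)%:E @[n --> \oo] --> f x by exact: cvg_nnsfun_approx.
transitivity (limn (fun n => \int[nu]_x (f_ n x)%:E)).
  rewrite -monotone_convergence//=.
  - by apply: eq_integral => x _; apply/esym/cvg_lim.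
  - by move=> n; exact/measurable_EFinP/measurable_funTS.
  - by move=> n x _; rewrite lee_fin.
  - by move=> x _ m n mn; rewrite lee_fin; exact/lefP/nd_nnsfun_approx.
under eq_fun do rewrite integral_density_nnsfun.
rewrite -monotone_convergence//=.
- apply: eq_integral => x _; apply/cvg_lim => //.
  by apply: cvgeZr => //.
- move=> n; apply/measurable_EFinP; apply: measurable_funM => //.
- by move=> n x _; rewrite mule_ge0 ?lee_fin.
- move=> x _ m n mn; rewrite lee_wpmul2r ?lee_fin//.
  exact/lefP/nd_nnsfun_approx.
Qed.

End density.

(** Open half-lines form a generating family stable under intersection, and the indicator of each is
    a pointwise limit of continuous functions with values in [0, 1]. *)
Lemma eq_measure_continuous (R : realType) (mu nu : probability R R) :
  (forall f : R -> R, continuous f -> (forall x, 0 <= f x <= 1) ->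
    (\int[mu]_x (f x)%:E = \int[nu]_x (f x)%:E)%E) ->
  forall A, measurable A -> mu A = nu A.
Proof.
move=> H.
pose G : set (set R) := [set A | exists x, A = `]x, +oo[%classic].
apply: (@measure_unique _ R R G (fun n => `](- n%:R), +oo[%classic)).
- exact: RGenOInfty.measurableE.
- move=> _ _ [x ->] [y ->]; exists (Num.max x y).
  by apply/seteqP; split => z /=; rewrite !in_itv/= !andbT gt_max;
    [move=> [-> ->]|move=> /andP[]].
- by move=> n; exists (- n%:R).
- rewrite -subTset => x _; exists (Num.truncn (- x)).+1 => //=.
  by rewrite in_itv/= andbT ltrNl Num.Theory.truncnS_gt.
- move=> _ [a ->].
  (* A ramp that is 0 up to [a] and then rises with slope [n] until it reaches 1. Being 0 at [a]
     itself, it tends to the indicator of the open half-line. *)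
  pose f (n : nat) (x : R) : R := Num.min 1 (n%:R * Num.max 0 (x - a)).
  have cf n : continuous (f n).
    move=> x.
    have := @continuous_min R R (cst 1 : R -> R^o)
      (fun x : R => (n%:R * Num.max 0 (x - a)) : R^o) x; apply.
      exact: cst_continuous.
    apply: cvgM; first exact: cvg_cst.
    have := @continuous_max R R (cst 0 : R -> R^o) (fun x : R => (x - a) : R^o) x.
    apply; first exact: cst_continuous.
    by apply: cvgB; [exact: cvg_id|exact: cvg_cst].
  have f01 n x : 0 <= f n x <= 1.
    rewrite /f ge_min lexx/= le_min ler01/= mulr_ge0 ?ler0n//.
    by rewrite le_max lexx.
  have flim x : (f n x)%:E @[n --> \oo] --> (\1_(`]a, +oo[%classic) x : R)%:E.
    apply/cvg_EFin; first by near=> n.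
    apply: cvg_near_cst; rewrite indicE; have [ax|xa] := ltP a x.
      rewrite mem_set/=; last by rewrite in_itv/= ax.
      near=> n; rewrite /f/= max_r ?subr_ge0 ?ltW//.
      apply/min_l; rewrite -ler_pdivrMr ?subr_gt0// div1r.
      near: n; exact: nbhs_infty_ger.
    rewrite memNset/=; last by rewrite in_itv/= andbT ltNge xa.
    near=> n; rewrite /f/= max_l ?subr_le0// mulr0.
    by apply/min_r; exact: ler01.
  have lim (la : probability R R) :
      (\int[la]_x (f n x)%:E @[n --> \oo] --> la `]a, +oo[%classic)%E.
    rewrite -(setIT `]a, +oo[%classic) -integral_indic//.
    apply: (@dominated_cvg _ _ _ la _ measurableT _ _ (cst 1%E)) => //.
    - move=> n; apply/measurable_EFinP.
      exact: continuous_measurable_fun.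
    - exact/finite_measure_integrable_cst.
    - by move=> n x _ /=; have /andP[f0 f1] := f01 n x;
        rewrite lee_fin ger0_norm.
  have fE : (fun n => \int[mu]_x (f n x)%:E)%E =
            (fun n => \int[nu]_x (f n x)%:E)%E.
    by apply/funext => n; exact: H.
  have := lim mu; rewrite fE => /cvg_unique; apply => //.
  exact: lim.
- by move=> n; exact: (le_lt_trans (probability_le1 _ _) (ltry _)).
Unshelve. all: by end_near. Qed.

(** * Normal laws as affine images of the standard one *)

Section normal_integral.
Context (R : realType).
Implicit Types (f : R -> R) (m s x : R).

Lemma normal_pdf_affine m s x : 0 < s ->
  normal_pdf m s (m + s * x) * s = normal_pdf 0 1 x.
Proof.
move=> s0; rewrite !normal_pdfE ?gt_eqF//= /normal_peak /normal_fun.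
rewrite expr1n mul1r subr0 addrAC subrr add0r.
rewrite -mulrnAr sqrtrM ?sqr_ge0// sqrtr_sqr gtr0_norm// invfM.
rewrite exprMn -mulrnAr -mulNr -[in LHS]mulNr.
rewrite mulrAC [s^-1 * _]mulrC mulfVK ?gt_eqF//.
congr (_ * expR _).
rewrite mulrnAr -mulrnAl.
field; rewrite gt_eqF//.
Qed.

Lemma ge0_integral_normal_prob m s (f : R -> \bar R) :
  measurable_fun setT f -> (forall x, 0 <= f x)%E ->
  (\int[normal_prob m s]_x f x =
   \int[lebesgue_measure]_x (f x * (normal_pdf m s x)%:E))%E.
Proof.
apply: (@ge0_integral_density _ _ _ lebesgue_measure) => //.
- exact: measurable_normal_pdf.
- by move=> x; exact: normal_pdf_ge0.
Qed.

End normal_integral.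

Lemma integral_cst_probability d (T : measurableType d) (R : realType)
  (P : probability T R) (c : \bar R) : (\int[P]_x c = c)%E.
Proof. by rewrite integral_cst// -[RHS]mule1; congr *%E; exact: probability_setT. Qed.

Section normal_law.
Context (R : realType).
Implicit Types (f : R -> R) (m s x : R).

Lemma measurable_id_measurableTypeR :
  @measurable_fun _ _ (measurableTypeR R) R setT id.
Proof. exact: measurable_id. Qed.

(* [normal_prob] lives on [measurableTypeR R], a structure on the reals that is
   not unifiable with the canonical one although it has the same sigma-algebra:
   the pushforward by the identity changes the structure. *)
Definition normal_real m s : probability R R :=
  @distribution _ _ (measurableTypeR R) R R (normal_prob m s)
    (@mfun_Sub _ _ (measurableTypeR R) R _
      (mem_set measurable_id_measurableTypeR)).

Lemma ge0_integral_normal_real m s (f : R -> \bar R) :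
  measurable_fun setT f -> (forall x, 0 <= f x)%E ->
  (\int[normal_real m s]_x f x =
   \int[lebesgue_measure]_x (f x * (normal_pdf m s x)%:E))%E.
Proof.
move=> mf f0; rewrite -ge0_integral_normal_prob//.
exact: (@ge0_integral_distribution _ _ (measurableTypeR R) R).
Qed.

Lemma integral_normal_real_affine m s f : 0 < s -> continuous f ->
  (forall x, 0 <= f x) ->
  (\int[normal_real m s]_x (f x)%:E =
   \int[normal_real 0 1]_x (f (m + s * x)%R)%:E)%E.
Proof.
move=> s0 cf f0.
have caff : continuous (fun x => m + s * x).
  move=> x; apply: cvgD; first exact: cvg_cst.
  by apply: cvgM; [exact: cvg_cst|exact: cvg_id].
have caf : continuous (fun x => f (m + s * x)).
  by move=> x; apply: continuous_comp; [exact: caff|exact: cf].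
rewrite ge0_integral_normal_real; last 2 first.
- by apply/measurable_EFinP; exact: continuous_measurable_fun.
- by move=> x; rewrite lee_fin.
rewrite ge0_integral_normal_real; last 2 first.
- by apply/measurable_EFinP; exact: continuous_measurable_fun.
- by move=> x; rewrite lee_fin.
under eq_integral do rewrite -EFinM.
have dF (x : R) : is_derive x 1 (fun x => m + s * x) s.
  have := is_deriveD (is_derive_cst m x 1)
    (@is_deriveZ _ _ _ (id : R -> R) s x 1 1 (is_derive_id x 1)).
  by rewrite add0r scaler1.
have dFE : (fun x => m + s * x)^`()%classic = cst s.
  by apply/funext => x; rewrite derive1E; exact: derive_val.
rewrite (@increasing_ge0_integration_by_substitutionT _ (fun x => m + s * x));
  first last.
- by move=> x; rewrite mulr_ge0// normal_pdf_ge0.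
- move=> x; apply: cvgM; first exact: cf.
  by apply: continuous_normal_pdf; rewrite gt_eqF.
- apply: (cvg_comp _ _ _ (@cvg_addrl R m)).
  by apply: gt0_cvgMry => //; exact: cvg_id.
- apply: (cvg_comp _ _ _ (@cvg_addrl_Ny R m)).
  by apply: gt0_cvgMrNy => //; exact: cvg_id.
- by move=> x; exact: (@ex_derive _ _ _ _ _ _ _ (dF x)).
- by rewrite dFE; exact: is_cvg_cst.
- by rewrite dFE; exact: is_cvg_cst.
- by rewrite dFE => x; exact: cvg_cst.
- by move=> x y xy; rewrite ltrD2l ltr_pM2l.
apply: eq_integral => x _; rewrite dFE/= -EFinM; congr EFin.
by rewrite /GRing.mul/= -mulrA normal_pdf_affine.
Qed.

Definition normal_law_prob m s : probability R R :=
  match s == 0 with true => \d_m | false => normal_real m s end.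

Lemma normal_law_probE m s A : normal_law_prob m s A = normal_law m s A.
Proof. by rewrite /normal_law_prob /normal_law; case: (s == 0). Qed.

(** All normal laws, degenerate ones included, become images of one fixed law under [m + s * x]. The
    parameters then sit in the integrand, where dominated convergence can handle them. *)
Lemma integral_normal_law_prob m s f : 0 <= s -> continuous f ->
  (forall x, 0 <= f x) ->
  (\int[normal_law_prob m s]_x (f x)%:E =
   \int[normal_real 0 1]_x (f (m + s * x)%R)%:E)%E.
Proof.
move=> s0 cf f0; rewrite /normal_law_prob; case: eqP => [->|/eqP sn0].
  rewrite integral_dirac//; last first.
    by apply/measurable_EFinP; exact: continuous_measurable_fun.
  rewrite diracT mul1e; under [RHS]eq_integral do rewrite mul0r addr0.
  exact/esym/integral_cst_probability.
by rewrite integral_normal_real_affine// lt_neqAle eq_sym sn0.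
Qed.

Context (dT : measure_display) (T : measurableType dT).
Variable P : probability T R.

Lemma integral_normal_rv (X : T -> R) m s f : measurable_fun setT X ->
  (forall A, measurable A -> pushforward P X A = normal_law m s A) ->
  0 <= s -> continuous f -> (forall x, 0 <= f x) ->
  (\int[P]_w (f (X w))%:E =
   \int[normal_real 0 1]_x (f (m + s * x)%R)%:E)%E.
Proof.
move=> mX XE s0 cf f0; rewrite -integral_normal_law_prob//.
transitivity (\int[pushforward P X]_x (f x)%:E)%E.
  rewrite (ge0_integral_pushforward mX)//.
  - by apply/measurable_EFinP; exact: continuous_measurable_fun.
  - by move=> y _; rewrite lee_fin.
apply: eq_measure_integral => A mA _.
by have := XE A mA; rewrite -normal_law_probE.
Qed.

(** A converse to [integral_normal_rv]: bounded continuous test functions suffice to identify the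
    law, by [eq_measure_continuous]. *)
Lemma normal_law_continuous (X : T -> R) m s : measurable_fun setT X -> 0 <= s ->
  (forall f, continuous f -> (forall x, 0 <= f x <= 1) ->
    (\int[P]_w (f (X w))%:E =
     \int[normal_real 0 1]_x (f (m + s * x)%R)%:E)%E) ->
  forall A, measurable A -> pushforward P X A = normal_law m s A.
Proof.
move=> mX s0 H A mA; rewrite -normal_law_probE.
pose X' : {mfun T >-> R} := mfun_Sub (mem_set mX).
apply: (@eq_measure_continuous _ (distribution P X') (normal_law_prob m s)) => //.
move=> f cf f01.
have f0 x : 0 <= f x by case/andP: (f01 x).
rewrite integral_normal_law_prob// -H// ge0_integral_distribution//.
by apply/measurable_EFinP; exact: continuous_measurable_fun.
Qed.

End normal_law.

(** * Moments of the standard normal law *)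

Section standard_normal_moments.
Context (R : realType).
Local Notation gam := (@normal_real R 0 1).

Lemma normal_sqr_lty : (\int[gam]_x ((x ^+ 2)%R%:E) < +oo)%E.
Proof.
rewrite ge0_integral_normal_real; last 2 first.
- by apply/measurable_EFinP; exact: measurable_funX.
- by move=> x; rewrite lee_fin sqr_ge0.
(* Since 1 + x^2/4 <= exp(x^2/4), one has x^2 exp(-x^2/2) <= 4 exp(-x^2/4), and the right-hand side
   is a multiple of the normal density of variance 2. The constant [c] below adjusts the normalizing
   factors. *)
pose s : R := Num.sqrt 2.
have s0 : 0 < s by rewrite sqrtr_gt0.
pose c : R := 4 * (normal_peak 1 / normal_peak s).
apply: (@le_lt_trans _ _ (\int[lebesgue_measure]_x (c * normal_pdf 0 s x)%:E)%E).
  apply: ge0_le_integral => //.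
  - by move=> x _; rewrite -EFinM lee_fin mulr_ge0 ?sqr_ge0 ?normal_pdf_ge0.
  - apply/measurable_EFinP/measurable_funM; last exact: measurable_normal_pdf.
    exact: measurable_funX.
  - apply/measurable_EFinP/measurable_funM; last exact: measurable_normal_pdf.
    exact: measurable_cst.
  - move=> x _; rewrite -EFinM lee_fin !normal_pdfE ?gt_eqF ?oner_neq0//.
    have e1 : normal_fun 0 1 x = expR (- (x ^+ 2 / 4)) * expR (- (x ^+ 2 / 4)).
      by rewrite -expRD /normal_fun subr0 expr1n; congr expR; field.
    have e2 : normal_fun 0 s x = expR (- (x ^+ 2 / 4)).
      by rewrite /normal_fun subr0 sqr_sqrtr ?ler0n//; congr expR; field.
    have p1 : 0 < normal_peak 1 :> R by rewrite normal_peak_gt0.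
    have ps : normal_peak s != 0 by rewrite gt_eqF// normal_peak_gt0// gt_eqF.
    rewrite e1 e2 /c; set q := expR _.
    have -> : 4 * (normal_peak 1 / normal_peak s) * (normal_peak s * q) =
      normal_peak 1 * q * 4 by field.
    have -> : x ^+ 2 * (normal_peak 1 * (q * q)) =
      normal_peak 1 * q * (x ^+ 2 * q) by ring.
    apply: ler_wpM2l; first by rewrite mulr_ge0 ?expR_ge0// ltW.
    rewrite -ler_pdivlMr ?expR_gt0//.
    rewrite /q expRN invrK; have := expR_ge1Dx (x ^+ 2 / 4); lra.
under eq_integral do rewrite EFinM.
rewrite integralZl//; last exact: integrable_normal_pdf.
by rewrite integral_normal_pdf mule1 ltry.
Qed.

Lemma integrable_normal_sqr : gam.-integrable setT (fun x => (x ^+ 2)%:E).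
Proof.
apply/integrableP; split.
  by apply/measurable_EFinP; exact: measurable_funX.
under eq_integral do rewrite gee0_abs ?lee_fin ?sqr_ge0//.
exact: normal_sqr_lty.
Qed.

Lemma integrable_normal_id : gam.-integrable setT (fun x => x%:E).
Proof.
apply: (@le_integrable _ _ _ gam setT measurableT _ (fun x => (1 + x ^+ 2)%:E)).
- exact/measurable_EFinP.
- move=> x _; rewrite !abse_EFin lee_fin.
  rewrite [leRHS]ger0_norm ?addr_ge0 ?sqr_ge0//.
  have := sqr_ge0 (`|x| - 1); rewrite sqrrB1 real_normK ?num_real//.
  have := normr_ge0 x; lra.
- under eq_fun do rewrite EFinD.
  apply: integrableD => //; last exact: integrable_normal_sqr.
  exact: finite_measure_integrable_cst.
Qed.

(** Both the density and Lebesgue measure are invariant under reflection. *)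
Lemma ge0_integral_normalN (f : R -> \bar R) :
  measurable_fun setT f -> (forall x, 0 <= f x)%E ->
  (\int[gam]_x f (- x)%R = \int[gam]_x f x)%E.
Proof.
move=> mf f0; rewrite !ge0_integral_normal_real//; last first.
  exact: measurableT_comp.
pose g (x : measurableTypeR R) : \bar R := (f x * (normal_pdf 0 1 x)%:E)%E.
have mg : measurable_fun setT g.
  apply: emeasurable_funM => //; apply/measurable_EFinP.
  exact: measurable_normal_pdf.
have g0 : {in setT, forall x, (0 <= g x)%E}.
  by move=> x _; rewrite mule_ge0// lee_fin normal_pdf_ge0.
have mN : measurable_fun setT (-%R : measurableTypeR R -> measurableTypeR R).
  exact: oppr_measurable.
transitivity (\int[lebesgue_measure]_x g (- x)%R)%E.
  apply: eq_integral => x _; rewrite /g; congr (_ * _%:E)%E.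
  by rewrite !normal_pdfE ?oner_neq0//= /normal_fun !subr0 sqrrN.
rewrite -[LHS](ge0_integral_pushforward mN lebesgue_measure measurableT mg g0).
apply: eq_measure_integral => A mA _; exact: lebesgue_measureN.
Qed.

Lemma integral_normal_id : (\int[gam]_x x%:E = 0)%E.
Proof.
rewrite integralE.
(* By symmetry the positive and negative parts have the same integral; it is finite, so the
   difference is 0. *)
have -> : (\int[gam]_x (fun x : R => x%:E)^\- x =
           \int[gam]_x (fun x : R => x%:E)^\+ x)%E.
  rewrite -[RHS]ge0_integral_normalN//.
    by apply: eq_integral => x _; rewrite funeposE funenegE EFinN.
  by apply: measurable_funepos; exact/measurable_EFinP.
by rewrite subee// integrable_pos_fin_num//; exact: integrable_normal_id.
Qed.

(** With t^2 = 1 + 2 s^2, the product of the integrand and the standard density is 1/t times the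
    centred normal density of standard deviation 1/t. *)
Lemma integral_normal_expR_sqr (s : R) :
  (\int[gam]_x (expR (- (s * x) ^+ 2))%:E = ((Num.sqrt (1 + s ^+ 2 *+ 2))^-1)%:E)%E.
Proof.
rewrite ge0_integral_normal_real; last 2 first.
- apply/measurable_EFinP; apply: measurableT_comp => //.
  apply: measurableT_comp => //; apply: measurable_funX.
  exact: measurable_funM.
- by move=> x; rewrite lee_fin expR_ge0.
set t := Num.sqrt _.
have t2 : t ^+ 2 = 1 + s ^+ 2 *+ 2.
  by rewrite sqr_sqrtr// addr_ge0// mulrn_wge0// sqr_ge0.
have t0 : 0 < t.
  by rewrite sqrtr_gt0 ltr_pwDl// mulrn_wge0// sqr_ge0.
have ti0 : 0 < t^-1 by rewrite invr_gt0.
transitivity (\int[lebesgue_measure]_x (t^-1%:E * (normal_pdf 0 t^-1 x)%:E))%E.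
  apply: eq_integral => x _; rewrite -!EFinM !normal_pdfE ?gt_eqF//.
  have -> : normal_peak t^-1 = t * normal_peak 1.
    rewrite /normal_peak expr1n mul1r -mulrnAr sqrtrM ?sqr_ge0// sqrtr_sqr.
    by rewrite (gtr0_norm ti0) invfM invrK.
  have -> : normal_fun 0 t^-1 x = expR (- (s * x) ^+ 2) * normal_fun 0 1 x.
    rewrite -expRD /normal_fun !subr0 expr1n exprVn t2; congr expR.
    by field; rewrite gt_eqF//; have := sqr_ge0 s; lra.
  by congr EFin; field; rewrite gt_eqF.
rewrite integralZl//; last exact: integrable_normal_pdf.
by rewrite integral_normal_pdf mule1.
Qed.

End standard_normal_moments.

(** * Pointwise limits of centred normal variables *)

Lemma bounded_cvg_integral d (T : measurableType d) (R : realType)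
    (mu : {finite_measure set T -> \bar R}) (S : set T) (f_ : nat -> T -> R)
    (f : T -> R) (M : R) :
  measurable S -> (forall n, measurable_fun S (f_ n)) ->
  (forall x, S x -> f_ n x @[n --> \oo] --> f x) ->
  (forall n x, S x -> `|f_ n x| <= M) ->
  (\int[mu]_(x in S) (f_ n x)%:E @[n --> \oo] --> \int[mu]_(x in S) (f x)%:E)%E.
Proof.
move=> mS mf ff fM.
apply: (@dominated_cvg _ _ _ mu _ mS _ _ (cst M%:E)) => //.
- by move=> n; exact/measurable_EFinP.
- by move=> x Sx; apply/cvg_EFin; [near=> n|exact: ff].
- by apply: finite_measure_integrable_cst.
Unshelve. all: by end_near. Qed.

Section centred_normal.
Context (R : realType) (dT : measure_display) (T : measurableType dT).
Variable P : probability T R.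
Local Notation gam := (@normal_real R 0 1).
Implicit Types (X : T -> R) (m s : R).

Definition has_normal_law X m s :=
  forall A : set R, measurable A -> pushforward P X A = normal_law m s A.

Lemma normal_law_sqr_integrable X m s : measurable_fun setT X -> 0 <= s ->
  has_normal_law X m s -> P.-integrable setT (fun w => (X w ^+ 2)%:E).
Proof.
move=> mX s0 XE; apply/integrableP; split.
  by apply/measurable_EFinP; exact: measurable_funX.
under eq_integral do rewrite gee0_abs ?lee_fin ?sqr_ge0//.
rewrite (integral_normal_rv mX XE s0 (f := fun x => x ^+ 2)); last 2 first.
- exact: exprn_continuous.
- by move=> x; exact: sqr_ge0.
(* The dominating function comes from (m + s x)^2 <= 2 m^2 + 2 s^2 x^2. *)
have ig : gam.-integrable setT
    (fun x : R => ((2 * m ^+ 2)%:E + (2 * s ^+ 2)%:E * (x ^+ 2)%:E)%E).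
  apply: integrableD => //; first exact: finite_measure_integrable_cst.
  by apply: integrableZl => //; exact: integrable_normal_sqr.
apply: le_lt_trans (integrable_lty _ ig) => //.
apply: ge0_le_integral => //.
- by move=> x _; rewrite lee_fin sqr_ge0.
- apply/measurable_EFinP; apply: measurable_funX; apply: measurable_funD => //.
- exact: measurable_int ig.
- move=> x _; rewrite -EFinM -EFinD lee_fin.
  by have := sqr_ge0 (m - s * x); nra.
Qed.

Lemma normal_law_integrable X m s : measurable_fun setT X -> 0 <= s ->
  has_normal_law X m s -> P.-integrable setT (EFin \o X).
Proof.
move=> mX s0 XE.
apply: (@le_integrable _ _ _ P setT measurableT _
  (fun w => (1 + X w ^+ 2)%:E)).
- exact/measurable_EFinP.
- move=> x _; rewrite !abse_EFin lee_fin.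
  rewrite [leRHS]ger0_norm ?addr_ge0 ?sqr_ge0//.
  have := sqr_ge0 (`|X x| - 1); rewrite sqrrB1 real_normK ?num_real//.
  have := normr_ge0 (X x); lra.
- under eq_fun do rewrite EFinD.
  apply: integrableD => //; first exact: finite_measure_integrable_cst.
  exact: normal_law_sqr_integrable mX s0 XE.
Qed.

(** [integral_normal_rv] transports nonnegative functions, so the positive and negative parts of [X]
    are transported separately and then recombined. *)
Lemma integral_normal_law X m s : measurable_fun setT X -> 0 <= s ->
  has_normal_law X m s -> (\int[P]_w (X w)%:E = m%:E)%E.
Proof.
move=> mX s0 XE.
have cpos : continuous (fun x : R => Num.max x 0).
  move=> x; have := @continuous_max R R id (cst 0 : R -> R^o) x.
  by apply; [exact: cvg_id|exact: cst_continuous].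
have cneg : continuous (fun x : R => Num.max (- x) 0).
  move=> x; have := @continuous_max R R (fun x => - x) (cst 0 : R -> R^o) x.
  by apply; [apply: cvgN; exact: cvg_id|exact: cst_continuous].
have Epos : (\int[P]_w (fun w => (X w)%:E)^\+ w =
    \int[gam]_x (fun x : R => (m + s * x)%:E)^\+ x)%E.
  have max0 x : 0 <= Num.max x 0 :> R by rewrite le_max lexx orbT.
  transitivity (\int[P]_w (Num.max (X w) 0)%:E)%E.
    by apply: eq_integral => x _; rewrite funeposE EFin_max.
  rewrite (integral_normal_rv mX XE s0 cpos max0).
  by apply: eq_integral => x _; rewrite funeposE EFin_max.
have Eneg : (\int[P]_w (fun w => (X w)%:E)^\- w =
    \int[gam]_x (fun x : R => (m + s * x)%:E)^\- x)%E.
  have max0 x : 0 <= Num.max (- x) 0 :> R by rewrite le_max lexx orbT.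
  transitivity (\int[P]_w (Num.max (- X w) 0)%:E)%E.
    by apply: eq_integral => x _; rewrite funenegE EFin_max EFinN.
  rewrite (integral_normal_rv mX XE s0 cneg max0).
  by apply: eq_integral => x _; rewrite funenegE EFin_max EFinN.
rewrite integralE Epos Eneg -integralE.
under eq_integral do rewrite EFinD EFinM.
rewrite integralD//; first last.
- by apply: integrableZl => //; exact: integrable_normal_id.
- exact: finite_measure_integrable_cst.
rewrite integral_cst_probability integralZl//; last exact: integrable_normal_id.
by rewrite integral_normal_id mule0 adde0.
Qed.

Definition sqr_moment : R := fine (\int[gam]_x (x ^+ 2)%:E)%E.

Lemma integral_normal_law_sqr X s : measurable_fun setT X -> 0 <= s ->
  has_normal_law X 0 s ->
  (\int[P]_w (X w ^+ 2)%:E = (s ^+ 2 * sqr_moment)%:E)%E.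
Proof.
move=> mX s0 XE.
rewrite (integral_normal_rv mX XE s0 (f := fun x => x ^+ 2)); last 2 first.
- exact: exprn_continuous.
- by move=> x; exact: sqr_ge0.
rewrite EFinM /sqr_moment fineK; last first.
  by apply: integrable_fin_num => //; exact: integrable_normal_sqr.
rewrite -integralZl//; last exact: integrable_normal_sqr.
by apply: eq_integral => x _; rewrite add0r exprMn.
Qed.

Lemma integral_continuous_cvg d' (T' : measurableType d') (Q : probability T' R)
    (Y_ : nat -> T' -> R) (Y : T' -> R) (f : R -> R) :
  (forall n, measurable_fun setT (Y_ n)) ->
  (forall w, Y_ n w @[n --> \oo] --> Y w) ->
  continuous f -> (forall x, 0 <= f x <= 1) ->
  (\int[Q]_w (f (Y_ n w))%:E @[n --> \oo] --> \int[Q]_w (f (Y w))%:E)%E.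
Proof.
move=> mY YY cf f01; apply: (@bounded_cvg_integral _ _ _ Q setT _ _ 1) => //.
- by move=> n; apply: measurableT_comp => //; exact: continuous_measurable_fun.
- by move=> w _; exact: (continuous_cvg _ (cf (Y w)) (YY w)).
- by move=> n w _; case/andP: (f01 (Y_ n w)) => f0 f1; rewrite ger0_norm.
Qed.

(** A zero integral would make [h] vanish almost everywhere; as [h] vanishes nowhere, the
    exceptional null set would be the whole space, of mass 1. *)
Lemma integral_gt0 (h : T -> R) : measurable_fun setT h ->
  (forall w, 0 < h w) -> (0 < \int[P]_w (h w)%:E)%E.
Proof.
move=> mh h0.
rewrite lt_neqAle integral_ge0 ?andbT; last by move=> w _; rewrite lee_fin ltW.
apply/eqP => E0.
have : (\int[P]_w `|(h w)%:E| = 0)%E.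
  rewrite E0; apply: eq_integral => w _.
  by rewrite gee0_abs// lee_fin ltW.
have mh' : measurable_fun setT (fun w => (h w)%:E) by exact/measurable_EFinP.
move=> /(ae_eq_integral_abs P measurableT mh').1 [N [mN PN subN]].
have NT : N = setT.
  rewrite -subTset; apply: subset_trans subN => w _ /= /(_ I)/eqP.
  by rewrite eqe gt_eqF.
have : P [set: T] = 0%E by rewrite -NT.
by rewrite probability_setT => /eqP; rewrite eqe oner_eq0.
Qed.

Lemma expR_sqr_itv (x : R) : 0 <= expR (- x ^+ 2) <= 1.
Proof. by rewrite expR_ge0/= -[leRHS]expR0 ler_expR oppr_le0 sqr_ge0. Qed.

Lemma continuous_expR_sqr : continuous (fun x : R => expR (- x ^+ 2)).
Proof.
move=> x; apply: continuous_comp; last exact: continuous_expR.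
by apply: cvgN; exact: exprn_continuous.
Qed.

Lemma integral_normal_law_expR X s : measurable_fun setT X -> 0 <= s ->
  has_normal_law X 0 s ->
  (\int[P]_w (expR (- X w ^+ 2))%:E =
   ((Num.sqrt (1 + s ^+ 2 *+ 2))^-1)%:E)%E.
Proof.
move=> mX s0 Xs.
rewrite (integral_normal_rv mX Xs s0 continuous_expR_sqr); last first.
  by move=> x; exact: expR_ge0.
under eq_integral do rewrite add0r.
exact: integral_normal_expR_sqr.
Qed.

(** The map s -> (1 + 2 s^2)^(-1/2) has a continuous inverse on (0, 1], so convergence of its values
    to a positive limit gives convergence of [s_]. Positivity of the limit is what prevents [s_]
    from escaping to infinity. *)
Lemma normal_law_cvg_sd (X_ : nat -> T -> R) (s_ : nat -> R) X :
  (forall n, measurable_fun setT (X_ n)) -> measurable_fun setT X ->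
  (forall n, 0 <= s_ n) ->
  (forall n, has_normal_law (X_ n) 0 (s_ n)) ->
  (forall w, X_ n w @[n --> \oo] --> X w) ->
  exists2 s : R, 0 <= s & s_ n @[n --> \oo] --> s.
Proof.
move=> mX_ mX s0 XE XX.
pose L_ n := (Num.sqrt (1 + s_ n ^+ 2 *+ 2))^-1.
set LE := (\int[P]_w (expR (- X w ^+ 2))%:E)%E.
have LE0 : (0 < LE)%E.
  apply: integral_gt0 => [|w]; last exact: expR_gt0.
  by apply: measurableT_comp (continuous_measurable_fun continuous_expR_sqr) mX.
have LEfin : LE \is a fin_num.
  rewrite ge0_fin_numE; last exact: ltW.
  apply: (@le_lt_trans _ _ (\int[P]_w 1%E)%E); last first.
    by rewrite integral_cst_probability ltry.
  apply: ge0_le_integral => //.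
  - apply/measurable_EFinP.
    by apply: measurableT_comp (continuous_measurable_fun continuous_expR_sqr) mX.
  - by move=> w _; rewrite lee_fin; case/andP: (expR_sqr_itv (X w)).
pose L := fine LE.
have L0 : 0 < L by rewrite -lte_fin fineK.
have cL : L_ n @[n --> \oo] --> L.
  have cLE : ((L_ n)%:E @[n --> \oo] --> L%:E)%E.
    rewrite fineK//.
    have := integral_continuous_cvg (Q := P) mX_ XX continuous_expR_sqr expR_sqr_itv.
    have -> : (fun n => \int[P]_w (expR (- X_ n w ^+ 2))%:E)%E =
        (fun n => (L_ n)%:E).
      apply/funext => n.
      exact: integral_normal_law_expR (mX_ n) (s0 n) (XE n).
    by [].
  exact: (fine_cvg cLE).
(* The solution s of L = (1 + 2 s^2)^(-1/2); the same formula recovers each [s_ n] from [L_ n]. *)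
exists (Num.sqrt ((L^-1 ^+ 2 - 1) / 2)); first exact: sqrtr_ge0.
have s_E n : s_ n = Num.sqrt (((L_ n)^-1 ^+ 2 - 1) / 2).
  rewrite /L_ invrK sqr_sqrtr; last first.
    by rewrite addr_ge0// mulrn_wge0// sqr_ge0.
  rewrite addrAC subrr add0r -[_ *+ 2]mulr_natr mulfK//.
  by rewrite sqrtr_sqr ger0_norm.
under eq_fun do rewrite s_E.
apply: continuous_cvg; first exact: sqrt_continuous.
apply: cvgM; last exact: cvg_cst.
apply: cvgB; last exact: cvg_cst.
have cLV : (L_ n)^-1 @[n --> \oo] --> L^-1 by apply: cvgV => //; rewrite gt_eqF.
exact: (cvgM cLV cLV).
Qed.

Lemma normal_law_cvg (X_ : nat -> T -> R) (s_ : nat -> R) X :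
  (forall n, measurable_fun setT (X_ n)) -> (forall n, 0 <= s_ n) ->
  (forall n, has_normal_law (X_ n) 0 (s_ n)) ->
  (forall w, X_ n w @[n --> \oo] --> X w) ->
  measurable_fun setT X /\
  exists s, [/\ 0 <= s, s_ n @[n --> \oo] --> s & has_normal_law X 0 s].
Proof.
move=> mX_ s0 XE XX.
have mX : measurable_fun setT X.
  by apply: (measurable_fun_cvg mX_) => w _; exact: XX.
split=> //.
have [s s_ge0 cs] := normal_law_cvg_sd mX_ mX s0 XE XX.
exists s; split=> //.
apply: normal_law_continuous => //.
move=> f cf f01.
have f0 x : 0 <= f x by case/andP: (f01 x).
(* The expectations of [f (X_ n w)] have two limits: one from the convergence of [X_], the other,
   over the standard normal law, from that of [s_]. Uniqueness identifies the law of [X]. *)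
have := integral_continuous_cvg (Q := P) mX_ XX cf f01.
under eq_fun do rewrite (integral_normal_rv (mX_ _) (XE _) (s0 _))//.
move=> /cvg_unique; apply => //.
apply: (@integral_continuous_cvg _ _ gam (fun n x => 0 + s_ n * x)) => //.
- by move=> n; apply: measurable_funD => //; exact: measurable_funM.
- move=> x; apply: cvgD; first exact: cvg_cst.
  by apply: cvgM => //; exact: cvg_cst.
Qed.

End centred_normal.

(** * Limits of linear combinations of a Gaussian field *)

Lemma centred_covariance d (T : measurableType d) (R : realType)
    (P : probability T R) (X Y : T -> R) :
  'E_P[X]%E = 0%E -> 'E_P[Y]%E = 0%E ->
  covariance P X Y = (\int[P]_w (X w * Y w)%:E)%E.
Proof.
move=> X0 Y0; rewrite covariance.unlock X0 Y0 /= unlock.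
by apply: eq_integral => w _ /=; rewrite !fctE /= !subr0.
Qed.

Section gaussian_combinations.
Context (R : realType) (dT : measure_display) (T : measurableType dT).
Variable P : probability T R.
Implicit Types (X Y : T -> R).

Definition centred_normal X := measurable_fun setT X /\
  exists2 s : R, 0 <= s & has_normal_law P X 0 s.

(** For centred variables this is the covariance, taken as a real number so that limits and sums
    stay in [R]. *)
Definition mixed_moment X Y : R := fine (\int[P]_w (X w * Y w)%:E)%E.

Lemma centred_normal_integral X : centred_normal X ->
  (\int[P]_w (X w)%:E = 0)%E.
Proof. by move=> [mX [s s0 Xs]]; exact: integral_normal_law mX s0 Xs. Qed.

Lemma centred_normal_sqr_integrable X : centred_normal X ->
  P.-integrable setT (fun w => (X w ^+ 2)%:E).
Proof. by move=> [mX [s s0 Xs]]; exact: normal_law_sqr_integrable mX s0 Xs. Qed.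

Lemma centred_normalM_integrable X Y : centred_normal X -> centred_normal Y ->
  P.-integrable setT (fun w => (X w * Y w)%:E).
Proof.
move=> nX nY.
apply: (@le_integrable _ _ _ P setT measurableT _
  (fun w => (X w ^+ 2 + Y w ^+ 2)%:E)).
- by apply/measurable_EFinP/measurable_funM; [case: nX|case: nY].
- move=> w _; rewrite !abse_EFin lee_fin.
  rewrite [leRHS]ger0_norm ?addr_ge0 ?sqr_ge0// normrM.
  rewrite -(real_normK (num_real (X w))) -(real_normK (num_real (Y w))).
  by have := sqr_ge0 (`|X w| - `|Y w|); nra.
- under eq_fun do rewrite EFinD.
  by apply: integrableD => //; exact: centred_normal_sqr_integrable.
Qed.

Lemma mixed_momentE X Y : centred_normal X -> centred_normal Y ->
  (\int[P]_w (X w * Y w)%:E = (mixed_moment X Y)%:E)%E.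
Proof.
move=> nX nY; rewrite fineK//.
by apply: integrable_fin_num => //; exact: centred_normalM_integrable.
Qed.

Lemma mixed_momentC X Y : mixed_moment X Y = mixed_moment Y X.
Proof.
by rewrite /mixed_moment; under eq_integral do rewrite mulrC.
Qed.

Lemma mixed_moment_linearl a X X' Y : centred_normal X -> centred_normal X' ->
  centred_normal Y ->
  mixed_moment (fun w => a * X w + X' w) Y =
  a * mixed_moment X Y + mixed_moment X' Y.
Proof.
move=> nX nX' nY; rewrite {1}/mixed_moment.
under eq_integral do rewrite mulrDl -mulrA EFinD EFinM.
rewrite integralD//=; last 2 first.
- by apply: integrableZl => //; exact: centred_normalM_integrable.
- exact: centred_normalM_integrable.
rewrite integralZl//; last exact: centred_normalM_integrable.
by rewrite !mixed_momentE.
Qed.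

Context (U : topologicalType) (D : set U) (Z : U -> T -> R).
Implicit Types (s : seq (R * U)).

(** A list of weights and points, possibly with repeated points: adding combinations is then
    concatenating lists. *)
Definition combination s (w : T) : R := \sum_(q <- s) q.1 * Z q.2 w.

Lemma combination_cons q s :
  combination (q :: s) = (fun w => q.1 * Z q.2 w + combination s w).
Proof. by apply/funext => w; rewrite /combination big_cons. Qed.

Lemma combination1 x : combination [:: (1, x)] = Z x.
Proof. by apply/funext => w; rewrite /combination big_seq1 mul1r. Qed.

Definition supported s := forall q, q \in s -> D q.2.

Hypothesis gaussianZ :
  gaussian_field P D (fun x w => const_mx (Z x w) : 'rV[R]_1).
Hypothesis centredZ :
  centred_field P D (fun x w => const_mx (Z x w) : 'rV[R]_1).

Lemma centred_at x : D x -> 'E_P[Z x]%E = 0%E.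
Proof.
move=> Dx; rewrite -(centredZ Dx ord0); congr ('E_P[_])%E.
by apply/funext => w; rewrite mxE.
Qed.

(** A nonempty list is a family of points indexed by its positions, to which the Gaussian hypothesis
    applies. The empty list is treated apart, as [gaussian_field] speaks of at least one point; its
    combination has the Dirac law at 0. *)
Lemma combination_normal_rv s : supported s -> normal_rv P (combination s).
Proof.
case: s => [_|q0 s0].
  have -> : combination [::] = cst 0.
    by apply/funext => w; rewrite /combination big_nil.
  split; first exact: measurable_cst.
  exists 0, 0; split=> // A mA; rewrite /normal_law eqxx diracE /pushforward.
  rewrite preimage_cst; case: ifP => _; first exact: probability_setT.
  exact: measure0.
set s := q0 :: s0 => Ds.
pose x (i : 'I_(size s)) := (tnth (in_tuple s) i).2.
have Dx i : D (x i) by apply: Ds; exact: mem_tnth.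
have [_ /(_ (fun ij => (tnth (in_tuple s) ij.1).1))] := gaussianZ (ltn0Sn _) Dx.
congr normal_rv; apply/funext => w.
rewrite /combination [RHS]big_tnth -(pair_bigA _ (fun i j =>
  (tnth (in_tuple s) i).1 * (const_mx (Z (x i) w) : 'rV_1) 0 j))/=.
by apply: eq_bigr => i _; rewrite big_ord1 mxE.
Qed.

Lemma field_integrable x : D x -> P.-integrable setT (fun w => (Z x w)%:E).
Proof.
move=> Dx; have := @combination_normal_rv [:: (1, x)].
rewrite combination1 => -[|mZ [m [s [s0 Zs]]]].
  by move=> q; rewrite inE => /eqP ->.
exact: normal_law_integrable mZ s0 Zs.
Qed.

Lemma integral_combination s : supported s ->
  P.-integrable setT (EFin \o combination s) /\
  (\int[P]_w (combination s w)%:E = 0)%E.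
Proof.
elim: s => [_|q s IH Ds].
  have comb0 w : combination [::] w = 0 by rewrite /combination big_nil.
  split.
    apply: (eq_integrable measurableT (cst 0%E)); last exact: integrable0.
    by move=> w _; rewrite /= comb0.
  by rewrite integral0_eq// => w _; rewrite comb0.
have [Is E0] : P.-integrable setT (EFin \o combination s) /\
    (\int[P]_w (combination s w)%:E = 0)%E.
  by apply: IH => r rs; apply: Ds; rewrite inE rs orbT.
have Dq : D q.2 by apply: Ds; rewrite inE eqxx.
have IZ := field_integrable Dq.
have Iq : P.-integrable setT (fun w => (q.1%:E * (Z q.2 w)%:E)%E).
  exact: integrableZl.
rewrite combination_cons; split.
  by rewrite /comp; under eq_fun do rewrite EFinD EFinM; exact: integrableD.
under eq_integral do rewrite EFinD EFinM.
rewrite integralD// E0 adde0 integralZl//.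
by have := centred_at Dq; rewrite unlock => ->; rewrite mule0.
Qed.

Lemma combination_centred_normal s : supported s ->
  centred_normal (combination s).
Proof.
move=> Ds; have [mX [m [sg [sg0 Xs]]]] := combination_normal_rv Ds.
split=> //; exists sg => //.
have [_] := integral_combination Ds.
by rewrite (integral_normal_law mX sg0 Xs) => -[<-].
Qed.

Lemma field_centred_normal x : D x -> centred_normal (Z x).
Proof.
move=> Dx; rewrite -combination1; apply: combination_centred_normal => q.
by rewrite inE => /eqP ->.
Qed.

(** The weights and points are deterministic, and convergence is required at every [w], which makes
    the limit measurable. *)
Definition approximates (S : nat -> seq (R * U)) X :=
  (forall n, supported (S n)) /\
  forall w, combination (S n) w @[n --> \oo] --> X w.

(** The second moment of a centred normal variable is a fixed multiple of its squared standard
    deviation, so it follows the convergence of standard deviations in [normal_law_cvg]. *)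
Lemma approximates_normal S X : approximates S X ->
  centred_normal X /\
  mixed_moment (combination (S n)) (combination (S n)) @[n --> \oo] -->
    mixed_moment X X.
Proof.
move=> [DS SX]; have nS n := combination_centred_normal (DS n).
have /choice[s_ s_P] n :
    exists sg : R, 0 <= sg /\ has_normal_law P (combination (S n)) 0 sg.
  by case: (nS n) => _ [sg sg0 Ss]; exists sg.
have [mX [s [s0 ss Xs]]] := normal_law_cvg (fun n => (nS n).1)
  (fun n => (s_P n).1) (fun n => (s_P n).2) SX.
split; first by split=> //; exists s.
have -> : mixed_moment X X = s ^+ 2 * sqr_moment R.
  rewrite /mixed_moment; under eq_integral do rewrite -expr2.
  by rewrite (integral_normal_law_sqr mX s0 Xs).
have -> : (fun n => mixed_moment (combination (S n)) (combination (S n))) =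
          (fun n => s_ n ^+ 2 * sqr_moment R).
  apply/funext => n; rewrite /mixed_moment.
  under eq_integral do rewrite -expr2.
  by rewrite (integral_normal_law_sqr (nS n).1 (s_P n).1 (s_P n).2).
apply: cvgM; last exact: cvg_cst.
exact: (cvgM ss ss).
Qed.

Lemma approximates_linear a S S' X Y : approximates S X -> approximates S' Y ->
  approximates (fun n => [seq (a * q.1, q.2) | q <- S n] ++ S' n)
    (fun w => a * X w + Y w).
Proof.
move=> [DS SX] [DS' SY]; split=> [n q|w].
  rewrite mem_cat => /orP[/mapP[r rS ->]|qS']; last exact: DS' qS'.
  exact: DS rS.
have -> : (fun n => combination ([seq (a * q.1, q.2) | q <- S n] ++ S' n) w) =
    (fun n => a * combination (S n) w + combination (S' n) w).
  apply/funext => n; rewrite /combination big_cat big_map/= mulr_sumr.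
  by congr (_ + _); apply: eq_bigr => q _; rewrite mulrA.
by apply: cvgD => //; apply: cvgM => //; exact: cvg_cst.
Qed.

(** The sum is written [1 * X w + Y w] to match [approximates_linear] and [mixed_moment_linearl] at
    coefficient 1. *)
Lemma mixed_moment_polarization X Y :
  centred_normal X -> centred_normal Y ->
  centred_normal (fun w => 1 * X w + Y w) ->
  mixed_moment X Y =
    (mixed_moment (fun w => 1 * X w + Y w) (fun w => 1 * X w + Y w) -
     mixed_moment X X - mixed_moment Y Y) / 2.
Proof.
move=> nX nY nXY.
rewrite (mixed_moment_linearl 1 nX nY nXY).
pose W w := 1 * X w + Y w.
rewrite (mixed_momentC X W) (mixed_momentC Y W).
rewrite (mixed_moment_linearl 1 nX nY nX) (mixed_moment_linearl 1 nX nY nY).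
by rewrite (mixed_momentC Y X); field.
Qed.

(** Polarization reduces this to the second moments of [X], [Y] and their sum, each the limit of a
    second moment by [approximates_normal]. *)
Lemma approximates_mixed_moment S S' X Y : approximates S X ->
  approximates S' Y ->
  mixed_moment (combination (S n)) (combination (S' n)) @[n --> \oo] -->
    mixed_moment X Y.
Proof.
move=> SX SY; have SXY := approximates_linear 1 SX SY.
have [nX cX] := approximates_normal SX.
have [nY cY] := approximates_normal SY.
have [nXY cXY] := approximates_normal SXY.
have combE n : combination ([seq (1 * q.1, q.2) | q <- S n] ++ S' n) =
    (fun w => 1 * combination (S n) w + combination (S' n) w).
  apply/funext => w; rewrite /combination big_cat big_map/= mulr_sumr.
  by congr (_ + _); apply: eq_bigr => q _; rewrite mulrA.
rewrite mixed_moment_polarization//.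
have -> : (fun n => mixed_moment (combination (S n)) (combination (S' n))) =
  (fun n => (mixed_moment (combination ([seq (1 * q.1, q.2) | q <- S n] ++ S' n))
     (combination ([seq (1 * q.1, q.2) | q <- S n] ++ S' n)) -
     mixed_moment (combination (S n)) (combination (S n)) -
     mixed_moment (combination (S' n)) (combination (S' n))) / 2).
  apply/funext => n; rewrite combE; apply: mixed_moment_polarization.
  - by apply: combination_centred_normal; exact: SX.1.
  - by apply: combination_centred_normal; exact: SY.1.
  - by rewrite -combE; apply: combination_centred_normal; exact: SXY.1.
apply: cvgM; last exact: cvg_cst.
by apply: cvgB => //; apply: cvgB.
Qed.

Variable k : U -> U -> R.
Hypothesis covZ : forall x y, D x -> D y -> covariance P (Z x) (Z y) = (k x y)%:E.

Lemma mixed_moment_field x y : D x -> D y -> mixed_moment (Z x) (Z y) = k x y.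
Proof.
move=> Dx Dy; rewrite /mixed_moment -centred_covariance ?centred_at//.
by rewrite covZ.
Qed.

Lemma mixed_moment_combination s s' : supported s -> supported s' ->
  mixed_moment (combination s) (combination s') =
  \sum_(q <- s) \sum_(r <- s') q.1 * r.1 * k q.2 r.2.
Proof.
have mm0 Y : mixed_moment (combination [::]) Y = 0.
  rewrite /mixed_moment; under eq_integral do rewrite /combination big_nil mul0r.
  by rewrite integral_cst_probability.
(* Linearity in the second argument, obtained from the first by symmetry. *)
have one q : D q.2 -> supported s' ->
    mixed_moment (Z q.2) (combination s') = \sum_(r <- s') r.1 * k q.2 r.2.
  move=> Dq; elim: s' => [_|r s' IH Ds].
    by rewrite mixed_momentC mm0 big_nil.
  have Dr : D r.2 by apply: Ds; rewrite inE eqxx.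
  have Ds' : supported s' by move=> t ts; apply: Ds; rewrite inE ts orbT.
  rewrite combination_cons mixed_momentC mixed_moment_linearl//.
  - by rewrite big_cons -IH// mixed_momentC mixed_moment_field// mixed_momentC.
  - exact: field_centred_normal.
  - exact: combination_centred_normal.
  - exact: field_centred_normal.
move=> + Ds'; elim: s => [_|q s IH Ds]; first by rewrite mm0 big_nil.
have Dq : D q.2 by apply: Ds; rewrite inE eqxx.
have Ds0 : supported s by move=> t ts; apply: Ds; rewrite inE ts orbT.
rewrite combination_cons mixed_moment_linearl//.
- rewrite big_cons IH// one// mulr_sumr; congr (_ + _).
  by apply: eq_bigr => r _; rewrite mulrA.
- exact: field_centred_normal.
- exact: combination_centred_normal.
- exact: combination_centred_normal.
Qed.

End gaussian_combinations.

(** * Riemann sums *)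

Section finite_range.
Context d (E : measurableType d) (R : realType) (mu : probability E R).
Variables (S : set E) (K : finType) (h : E -> K) (G : K -> R).
Hypothesis mS : measurable S.
Hypothesis mh : forall k, measurable (S `&` h @^-1` [set k]).

Lemma measurable_finite_range : measurable_fun S (G \o h).
Proof.
move=> _ B mB.
rewrite (_ : S `&` _ = \bigcup_(k in [set k | B (G k)]) (S `&` h @^-1` [set k])).
  apply: fin_bigcup_measurable => [|k _]; last exact: mh.
  exact: finite_finset.
apply/seteqP; split => [x [Sx Bx]|x [k Bk [Sx hk]]].
  by exists (h x).
by split=> //=; rewrite hk.
Qed.

Lemma Rintegral_finite_range :
  (\int[mu]_(x in S) G (h x) =
   \sum_k fine (mu (S `&` h @^-1` [set k])) * G k)%R.
Proof.
have int1 k : mu.-integrable S (fun x => (\1_(S `&` h @^-1` [set k]) x)%:E).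
  apply: (integrableS measurableT) => //.
  exact: integrable_indic.
have -> : (\int[mu]_(x in S) G (h x) =
    fine (\int[mu]_(x in S)
      (\sum_k (G k)%:E * (\1_(S `&` h @^-1` [set k]) x)%:E)%E))%R.
  congr fine; apply: eq_integral => x; rewrite inE => Sx.
  rewrite (bigD1 (h x))//= indicE mem_set// mule1 big1 ?adde0// => k kh.
  by rewrite indicE memNset ?mule0// => -[_ /= hk]; rewrite hk eqxx in kh.
rewrite integral_sum//; last by move=> k; exact: integrableZl.
rewrite (eq_bigr (fun k => (fine (mu (S `&` h @^-1` [set k])) * G k)%:E)).
  by rewrite sumEFin.
move=> k _; rewrite integralZl// integral_indic// setIAC setIid mulrC EFinM.
by rewrite fineK// fin_num_measure.
Qed.

End finite_range.

(** The bound [M] passes to the limit, so [f] is integrable and its extended integral is finite;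
    taking [fine] then preserves the convergence. *)
Lemma bounded_cvg_Rintegral d (T : measurableType d) (R : realType)
    (mu : probability T R) (S : set T) (f_ : nat -> T -> R) (f : T -> R) (M : R) :
  measurable S -> (forall n, measurable_fun S (f_ n)) ->
  (forall x, S x -> f_ n x @[n --> \oo] --> f x) ->
  (forall n x, S x -> `|f_ n x| <= M) ->
  (\int[mu]_(x in S) f_ n x @[n --> \oo] --> \int[mu]_(x in S) f x)%R.
Proof.
move=> mS mf ff fM.
suff fi : mu.-integrable S (EFin \o f).
  have := bounded_cvg_integral (mu := mu) mS mf ff fM.
  by rewrite -(fineK (integrable_fin_num mS fi)) => /fine_cvg.
apply: (@le_integrable _ _ _ mu S mS _ (cst M%:E)).
- by apply/measurable_EFinP; exact: measurable_fun_cvg mf ff.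
- move=> x Sx; rewrite !abse_EFin lee_fin.
  have : `|f_ n x| @[n --> \oo] --> `|f x| by apply: cvg_norm; exact: ff.
  move=> /cvg_lim <-//; apply: limr_le.
    by apply: is_cvg_norm; apply/cvg_ex; exists (f x); exact: ff.
  near=> n; apply: le_trans (ler_norm M); exact: fM.
- exact: finite_measure_integrable_cst.
Unshelve. all: by end_near. Qed.

(** * Sequential continuity on a subset *)

Definition seq_continuous_on (U V : topologicalType) (A : set U) (f : U -> V) :=
  forall (x_ : nat -> U) x, (forall n, A (x_ n)) -> A x ->
    x_ n @[n --> \oo] --> x -> f (x_ n) @[n --> \oo] --> f x.

Lemma within_continuous_seq (U V : topologicalType) (A : set U) (f : U -> V) :
  {within A, continuous f} -> seq_continuous_on A f.
Proof.
move=> /subspace_continuousP cf x_ x Ax_ Ax xx.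
move=> B /(cf x Ax)/xx nB.
have [N _ NB] := nB; exists N => // n Nn.
by apply: (NB n Nn); exact: Ax_.
Qed.

(** If continuity fails at [x] for some [e], choosing a bad point of [A] within 1/(n+1) of [x] for
    every [n] gives a sequence that contradicts sequential continuity. *)
Lemma seq_within_continuous (R : realType) (U V : pseudoMetricType R)
    (A : set U) (f : U -> V) :
  seq_continuous_on A f -> {within A, continuous f}.
Proof.
move=> sf; apply/subspace_continuousP => x Ax.
apply/cvg_ballP => e e0; apply: contrapT => nH.
have /choice[y_ yP] n : exists y, [/\ A y, ball x n.+1%:R^-1 y &
    ~ ball (f x) e (f y)].
  apply: contrapT => nE; apply: nH.
  have n0 : 0 < n.+1%:R^-1 :> R by rewrite invr_gt0.
  have := nbhsx_ballx x _ n0; apply: filterS => y By Ay.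
  by apply: contrapT => nB; apply: nE; exists y.
have yx : y_ n @[n --> \oo] --> x.
  apply/cvg_ballP => r r0; near=> n.
  have [_ + _] := yP n; apply: le_ball; apply: ltW.
  near: n; exact: near_infty_natSinv_lt (PosNum r0).
have /cvg_ballP/(_ e e0) := sf y_ x (fun n => let: And3 Ay _ _ := yP n in Ay) Ax yx.
move=> [n _ /(_ n (leqnn n)) /= fy].
by have [_ _] := yP n; apply.
Unshelve. all: by end_near. Qed.

(** * Cells of a partition and their sample points *)

Section sampling.
Context (R : realType) (d : nat).
Local Notation U := 'rV[R]_d.
Implicit Types (x : U) (n : nat).

Lemma cvg_row (x_ : nat -> U) x :
  (forall i, x_ n 0 i @[n --> \oo] --> x 0 i) -> x_ n @[n --> \oo] --> x.
Proof.
move=> H; apply/cvg_ballP => e e0.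
have : \forall n \near \oo, forall i, ball (x 0 i) e (x_ n 0 i).
  by apply: filter_forall => i; have /cvg_ballP := H i; apply.
by apply: filterS => n xn; split=> // i j; rewrite ord1.
Qed.

(* Points of the [n]-th cell structure are told apart by comparing their
   coordinates with the first [n] rationals; the diameters of the cells need not
   be controlled, since the cells around each single point shrink to it. *)
Definition threshold (j : nat) : R := ratr (odflt 0 (unpickle j)).

Definition cell n x : {ffun 'I_d * 'I_n -> bool} :=
  [ffun ij : 'I_d * 'I_n => x 0 ij.1 <= threshold ij.2].

Variables (A : set U) (x0 : U).
Hypothesis Ax0 : A x0.

(** A representative in [A] of the cell labelled [k]. The default [x0], for cells that miss [A],
    also lies in [A], so every sample point does. *)
Definition sample n (k : {ffun 'I_d * 'I_n -> bool}) : U :=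
  xget x0 [set y | A y /\ cell n y = k].

Lemma sample_in n k : A (@sample n k).
Proof. by rewrite /sample; case: xgetP => [y -> []|]. Qed.

Lemma cell_sample n x : A x -> cell n (sample (cell n x)) = cell n x.
Proof.
move=> Ax; rewrite /sample; case: xgetP => [y -> []//|/(_ x) []].
by split.
Qed.

Lemma thresholdP (a b : R) : a < b -> exists j, a < threshold j < b.
Proof.
move=> /rat_in_itvoo[q]; rewrite in_itv/= => abq.
by exists (pickle q); rewrite /threshold pickleK.
Qed.

(** In each coordinate, pick rationals a in (x_i - e, x_i) and b in (x_i, x_i + e). Once both are
    among the first [n] thresholds, the sample point, being in the cell of [x], has its coordinate
    in (a, b]. *)
Lemma sample_cvg x : A x -> sample (cell n x) @[n --> \oo] --> x.
Proof.
move=> Ax; apply: cvg_row => i; apply/cvgrPdist_lt => e e0.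
have [a /andP[ax xa]] : exists j, x 0 i - e < threshold j < x 0 i.
  by apply: thresholdP; rewrite ltrBlDr ltrDl.
have [b /andP[xb bx]] : exists j, x 0 i < threshold j < x 0 i + e.
  by apply: thresholdP; rewrite ltrDl.
near=> n.
have an : (a < n)%N by near: n; exact: nbhs_infty_gt.
have bn : (b < n)%N by near: n; exact: nbhs_infty_gt.
have /ffunP cE := cell_sample n Ax.
have := cE (i, Ordinal an); have := cE (i, Ordinal bn).
rewrite !ffunE/= (ltW xb) leNgt => yb.
rewrite [in RHS]leNgt xa/= => /negbT; rewrite -ltNge => ya.
rewrite ltr_distlC; apply/andP; split; first exact: lt_trans ya.
by move: yb; rewrite -leNgt => yb; exact: le_lt_trans bx.
Unshelve. all: by end_near. Qed.

End sampling.

Section riemann_sums.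
Context (R : realType) (d : nat).
Local Notation U := 'rV[R]_d.
Variables (A : set U) (x0 : U).
Hypothesis Ax0 : A x0.

Lemma measurable_cell dE (E : measurableType dE) (phi : E -> U) n k :
  (forall i, measurable_fun setT (fun z => phi z 0 i)) ->
  measurable ((cell n \o phi) @^-1` [set k]).
Proof.
move=> mphi.
rewrite (_ : _ @^-1` _ = \bigcap_(ij in [set: 'I_d * 'I_n])
    (fun z => phi z 0 ij.1 <= threshold R ij.2) @^-1` [set k ij]).
  apply: fin_bigcap_measurable => [|ij _]; first exact: finite_finset.
  rewrite -[X in measurable X]setTI.
  by apply: measurable_fun_ler => //; exact: measurable_cst.
apply/seteqP; split => [z /= <- ij _ /=|z H]; first by rewrite ffunE.
by apply/ffunP => ij; rewrite /= ffunE; exact: (H ij I).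
Qed.

Section one_integral.
Context (dE : measure_display) (E : measurableType dE) (mu : probability E R).
Variables (S : set E) (phi : E -> U).
Hypothesis mS : measurable S.
Hypothesis mphi : forall i, measurable_fun setT (fun z => phi z 0 i).
Hypothesis Aphi : forall z, S z -> A (phi z).

Definition riemann_cell n k : set E := S `&` (cell n \o phi) @^-1` [set k].

(** Only weights and points are recorded, independently of any integrand: one list serves all paths
    of a random field and has the shape that [combination] expects. *)
Definition riemann_sum n : seq (R * U) :=
  [seq (fine (mu (riemann_cell k)), sample A x0 k) |
    k : {ffun 'I_d * 'I_n -> bool}].

Lemma measurable_riemann_cell n (k : {ffun 'I_d * 'I_n -> bool}) :
  measurable (riemann_cell k).
Proof. by apply: measurableI => //; exact: measurable_cell. Qed.

Lemma riemann_sum_in n q : q \in riemann_sum n -> A q.2.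
Proof. by move=> /mapP[k _ ->]; exact: sample_in. Qed.

(** Each sum is exactly the integral of the step function that replaces a point by the sample of its
    cell; bounded convergence applies to these functions. *)
Lemma riemann_sum_cvg (F : U -> R) (M : R) :
  seq_continuous_on A F -> (forall x, A x -> `|F x| <= M) ->
  (\sum_(q <- riemann_sum n) q.1 * F q.2 @[n --> \oo] -->
    \int[mu]_(z in S) F (phi z))%R.
Proof.
move=> cF FM.
have -> : (fun n => \sum_(q <- riemann_sum n) q.1 * F q.2) =
    (fun n => \int[mu]_(z in S) (F \o @sample _ _ A x0 n) ((cell n \o phi) z))%R.
  apply/funext => n; rewrite (Rintegral_finite_range mu _ mS
    (@measurable_riemann_cell n)).
  by rewrite /riemann_sum big_map big_enum.
apply: (bounded_cvg_Rintegral (mu := mu) (M := M) mS).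
- by move=> n; apply: measurable_finite_range => // k; exact: measurable_riemann_cell.
- move=> z Sz; apply: cF; [by move=> n; exact: sample_in|exact: Aphi|].
  by apply: sample_cvg => //; exact: Aphi.
- by move=> n z Sz; apply: FM; exact: sample_in.
Qed.

Lemma measurable_seq_continuous_comp (F : U -> R) :
  seq_continuous_on A F -> measurable_fun S (fun z => F (phi z)).
Proof.
move=> cF; apply: (@measurable_fun_cvg _ _ _ _
  (fun n => (F \o @sample _ _ A x0 n) \o (cell n \o phi))).
  by move=> n; apply: measurable_finite_range => // k; exact: measurable_riemann_cell.
move=> z Sz; apply: cF; [by move=> n; exact: sample_in|exact: Aphi|].
by apply: sample_cvg => //; exact: Aphi.
Qed.

End one_integral.

Context (d1 d2 : measure_display).
Context (E1 : measurableType d1) (E2 : measurableType d2).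
Variables (mu1 : probability E1 R) (mu2 : probability E2 R).
Variables (S1 : set E1) (S2 : set E2) (phi1 : E1 -> U) (phi2 : E2 -> U).
Hypotheses (mS1 : measurable S1) (mS2 : measurable S2).
Hypothesis mphi1 : forall i, measurable_fun setT (fun z => phi1 z 0 i).
Hypothesis mphi2 : forall i, measurable_fun setT (fun z => phi2 z 0 i).
Hypothesis Aphi1 : forall z, S1 z -> A (phi1 z).
Hypothesis Aphi2 : forall z, S2 z -> A (phi2 z).

(** As for one integral: cells of the product are products of cells, so their measures are the
    products of the weights. *)
Lemma riemann_sum2_cvg (F : U -> U -> R) (M : R) :
  (forall x_ y_ x y, (forall n, A (x_ n)) -> (forall n, A (y_ n)) -> A x -> A y ->
    x_ n @[n --> \oo] --> x -> y_ n @[n --> \oo] --> y ->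
    F (x_ n) (y_ n) @[n --> \oo] --> F x y) ->
  (forall x y, A x -> A y -> `|F x y| <= M) ->
  (\sum_(q <- riemann_sum mu1 S1 phi1 n) \sum_(r <- riemann_sum mu2 S2 phi2 n)
     q.1 * r.1 * F q.2 r.2 @[n --> \oo] -->
    \int[(mu1 \x mu2)%E]_(z in S1 `*` S2) F (phi1 z.1) (phi2 z.2))%R.
Proof.
move=> cF FM.
pose h n (z : E1 * E2) := (cell n (phi1 z.1), cell n (phi2 z.2)).
pose G n (k : {ffun 'I_d * 'I_n -> bool} * {ffun 'I_d * 'I_n -> bool}) :=
  F (sample A x0 k.1) (sample A x0 k.2).
have hE n k : (S1 `*` S2) `&` h n @^-1` [set k] =
    riemann_cell S1 phi1 k.1 `*` riemann_cell S2 phi2 k.2.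
  apply/seteqP; split => [[z1 z2] [[/= ? ?] <-]//|[z1 z2] [[/= ? h1] [/= ? h2]]].
  by split => //=; rewrite /h/= h1 h2 -surjective_pairing.
have mS : measurable (S1 `*` S2) by exact: measurableX.
have mh n k : measurable ((S1 `*` S2) `&` h n @^-1` [set k]).
  by rewrite hE; apply: measurableX; exact: measurable_riemann_cell.
have -> : (fun n => \sum_(q <- riemann_sum mu1 S1 phi1 n)
      \sum_(r <- riemann_sum mu2 S2 phi2 n) q.1 * r.1 * F q.2 r.2) =
    (fun n => \int[(mu1 \x mu2)%E]_(z in S1 `*` S2) G n (h n z))%R.
  apply/funext => n.
  rewrite (Rintegral_finite_range [the probability _ R of (mu1 \x mu2)%E]
    (G n) mS (mh n)).
  rewrite /riemann_sum big_map big_enum/=.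
  under eq_bigr do rewrite big_map big_enum/=.
  rewrite pair_big/=; apply: eq_bigr => k _.
  congr (_ * _); rewrite hE.
  rewrite -fineM ?fin_num_measure//; try exact: measurable_riemann_cell.
  by congr fine; apply/esym/product_measure1E; exact: measurable_riemann_cell.
apply: (bounded_cvg_Rintegral (mu := [the probability _ R of (mu1 \x mu2)%E])
  (M := M) mS).
- by move=> n; exact: (measurable_finite_range (G n) (mh n)).
- move=> z [Sz1 Sz2]; apply: cF.
  + by move=> n; exact: sample_in.
  + by move=> n; exact: sample_in.
  + exact: Aphi1.
  + exact: Aphi2.
  + by apply: sample_cvg => //; exact: Aphi1.
  + by apply: sample_cvg => //; exact: Aphi2.
- by move=> n z _; apply: FM; exact: sample_in.
Qed.

End riemann_sums.

(** * The operators [T_op] applied to a Gaussian field *)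

Section merge.
Context (R : realType) (d : nat).
Implicit Types (D : 'I_d -> set R) (u : {set 'I_d}) (x : 'rV[R]_d).

Lemma index_enum_lt u i : i \notin u -> (index i (enum (~: u)) < #|~: u|)%N.
Proof. by move=> iu; rewrite cardE index_mem mem_enum inE. Qed.

Lemma merge_coord_notin u x z i (iu : i \notin u) :
  merge_coord u x z 0 i = tnth z (Ordinal (index_enum_lt iu)).
Proof. by rewrite mxE (negbTE iu) (tnth_nth 0). Qed.

Lemma merge_coord_in u x z i : i \in u -> merge_coord u x z 0 i = x 0 i.
Proof. by move=> iu; rewrite mxE iu. Qed.

Lemma box_merge_coord D u x z :
  box D x -> box_minus D u z -> box D (merge_coord u x z).
Proof.
move=> Dx Dz i; have [iu|iu] := boolP (i \in u); first by rewrite merge_coord_in.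
rewrite merge_coord_notin; have := Dz (Ordinal (index_enum_lt iu)).
by rewrite (enum_val_nth i)/= nth_index// mem_enum inE.
Qed.

Lemma measurable_merge_coord u x i :
  measurable_fun setT (fun z => merge_coord u x z 0 i).
Proof.
have [iu|iu] := boolP (i \in u).
  by under eq_fun do rewrite merge_coord_in//; exact: measurable_cst.
under eq_fun do rewrite (merge_coord_notin _ _ iu); exact: measurable_tnth.
Qed.

Lemma measurable_box_minus D u :
  (forall i, measurable (D i)) -> measurable (box_minus D u).
Proof.
move=> mD; rewrite (_ : box_minus D u = \bigcap_(k in [set: 'I_#|~: u|])
    ((@tnth _ R)^~ k @^-1` D (enum_val k))).
  apply: fin_bigcap_measurable => // k _.
  by rewrite -[X in measurable X]setTI; exact: measurable_tnth.
by apply/seteqP; split => z /= H k => [_|]; exact: H.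
Qed.

Lemma cvg_merge_coord u (x_ : nat -> 'rV[R]_d) x z :
  x_ n @[n --> \oo] --> x ->
  merge_coord u (x_ n) z @[n --> \oo] --> merge_coord u x z.
Proof.
move=> xx; apply: cvg_row => i; have [iu|iu] := boolP (i \in u).
  under eq_fun do rewrite merge_coord_in//; rewrite merge_coord_in//.
  exact: (continuous_cvg _ (@coord_continuous R 1 d 0 i x) xx).
under eq_fun do rewrite (merge_coord_notin _ _ iu).
by rewrite merge_coord_notin; exact: cvg_cst.
Qed.

End merge.

Section approximable.
Context (R : realType) (dT : measure_display) (T : measurableType dT).
Variable P : probability T R.
Context (U : topologicalType) (D : set U) (Z : U -> T -> R).
Hypothesis gaussianZ :
  gaussian_field P D (fun x w => const_mx (Z x w) : 'rV[R]_1).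
Hypothesis centredZ :
  centred_field P D (fun x w => const_mx (Z x w) : 'rV[R]_1).

Definition approximable (X : T -> R) := exists S, approximates D Z S X.

Lemma approximable_normal X : approximable X -> centred_normal P X.
Proof. by move=> [S /(approximates_normal gaussianZ centredZ)[]]. Qed.

Lemma approximable_sum (I : Type) (r : seq I) (p : pred I) (a : I -> R)
    (X : I -> T -> R) : (forall i, p i -> approximable (X i)) ->
  approximable (fun w => \sum_(i <- r | p i) a i * X i w).
Proof.
move=> aX; elim: r => [|i r [S IH]].
  exists (fun=> [::]); split=> // w; rewrite big_nil.
  by rewrite /combination; under eq_fun do rewrite big_nil; exact: cvg_cst.
under eq_fun do rewrite big_cons.
have [pi|npi] := boolP (p i); last by exists S.
have [S' iS'] := aX i pi.
by eexists; exact: approximates_linear iS' IH.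
Qed.

Lemma mixed_moment_suml (I : Type) (r : seq I) (p : pred I) (a : I -> R)
    (X : I -> T -> R) (Y : T -> R) : (forall i, p i -> approximable (X i)) ->
  approximable Y ->
  mixed_moment P (fun w => \sum_(i <- r | p i) a i * X i w) Y =
  \sum_(i <- r | p i) a i * mixed_moment P (X i) Y.
Proof.
move=> aX aY; elim: r => [|i r IH].
  rewrite big_nil /mixed_moment integral0_eq// => w _.
  by rewrite big_nil mul0r.
rewrite big_cons; under eq_fun do rewrite big_cons.
have [pi|npi] := boolP (p i); last exact: IH.
rewrite mixed_moment_linearl ?IH//; apply: approximable_normal => //.
  exact: aX.
exact: approximable_sum.
Qed.

Variable k : U -> U -> R.
Hypothesis covZ : forall x y, D x -> D y -> covariance P (Z x) (Z y) = (k x y)%:E.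
Hypothesis pathsZ : forall w, seq_continuous_on D (fun x => Z x w).

(** By continuity of paths, the one-point combinations at [x_ n] approximate the field at [x]; their
    mixed moments, which are values of [k], therefore converge. *)
Lemma covariance_seq_continuous x_ y_ x y :
  (forall n, D (x_ n)) -> (forall n, D (y_ n)) -> D x -> D y ->
  x_ n @[n --> \oo] --> x -> y_ n @[n --> \oo] --> y ->
  k (x_ n) (y_ n) @[n --> \oo] --> k x y.
Proof.
move=> Dx_ Dy_ Dx Dy xx yy.
have app (z_ : nat -> U) z : (forall n, D (z_ n)) -> D z ->
    z_ n @[n --> \oo] --> z -> approximates D Z (fun n => [:: (1, z_ n)]) (Z z).
  move=> Dz_ Dz zz; split=> [n q|w].
    by rewrite inE => /eqP ->; exact: Dz_.
  by under eq_fun do rewrite combination1; exact: pathsZ.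
have := approximates_mixed_moment gaussianZ centredZ (app _ _ Dx_ Dx xx)
  (app _ _ Dy_ Dy yy).
rewrite (mixed_moment_field centredZ covZ Dx Dy).
have -> // : (fun n => mixed_moment P (combination Z [:: (1, x_ n)])
    (combination Z [:: (1, y_ n)])) = (fun n => k (x_ n) (y_ n)).
apply/funext => n; rewrite !combination1.
exact: (mixed_moment_field centredZ covZ).
Qed.

(** The second moment of [a * Z x w + Z y w] is nonnegative; take [a] to be 1 and -1. This reduces
    bounding [k] to bounding its diagonal. *)
Lemma normr_covariance_le x y : D x -> D y -> `|k x y| <= k x x + k y y.
Proof.
move=> Dx Dy.
have nZ z : D z -> centred_normal P (Z z) by exact: field_centred_normal.
have sq a : 0 <= a ^+ 2 * k x x + 2 * a * k x y + k y y.
  have nW : centred_normal P (fun w => a * Z x w + Z y w).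
    apply: approximable_normal.
    have [Sx Sy] : approximable (Z x) /\ approximable (Z y).
      by split; [exists (fun=> [:: (1, x)])|exists (fun=> [:: (1, y)])];
        (split=> [n q|w]; [rewrite inE => /eqP -> //|
          under eq_fun do rewrite combination1; exact: cvg_cst]).
    have [S1 H1] := Sx; have [S2 H2] := Sy.
    by eexists; exact: approximates_linear H1 H2.
  pose W w := a * Z x w + Z y w.
  have W0 : 0 <= mixed_moment P W W.
    by apply: fine_ge0; apply: integral_ge0 => w _; rewrite lee_fin -expr2 sqr_ge0.
  move: W0; rewrite /W (mixed_moment_linearl a (nZ _ Dx) (nZ _ Dy) nW).
  rewrite (mixed_momentC _ (Z x) W) (mixed_momentC _ (Z y) W).
  rewrite (mixed_moment_linearl a (nZ _ Dx) (nZ _ Dy) (nZ _ Dx)).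
  rewrite (mixed_moment_linearl a (nZ _ Dx) (nZ _ Dy) (nZ _ Dy)).
  rewrite (mixed_momentC _ (Z y) (Z x)) !(mixed_moment_field centredZ covZ)//.
  lra.
have := sq 1; have := sq (- 1); rewrite sqrrN expr1n ler_norml => h1 h2.
by apply/andP; split; lra.
Qed.

End approximable.

(** * Partial integrals of the field and their signed sums *)

Section T_op_field.
Context (R : realType) (d : nat) (D : 'I_d -> set R).
Hypothesis hD : forall i, compact (D i).
Variable nu : 'I_d -> probability R R.
Context (dT : measure_display) (T : measurableType dT) (P : probability T R).
Variables (Z : 'rV[R]_d -> T -> R) (k : 'rV[R]_d -> 'rV[R]_d -> R).
Hypothesis hgauss :
  gaussian_field P (box D) (fun x w => const_mx (Z x w) : 'rV[R]_1).
Hypothesis hcentred :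
  centred_field P (box D) (fun x w => const_mx (Z x w) : 'rV[R]_1).
Hypothesis hcov : forall x y, box D x -> box D y ->
  covariance P (Z x) (Z y) = (k x y)%:E.
Hypothesis hpaths :
  continuous_paths (box D) (fun x w => const_mx (Z x w) : 'rV[R]_1).
Implicit Types (u v : {set 'I_d}) (x y : 'rV[R]_d).

Lemma compact_box : compact (box D).
Proof. exact: rV_compact. Qed.

Lemma seq_continuous_bounded (F : 'rV[R]_d -> R) :
  seq_continuous_on (box D) F -> exists M, forall x, box D x -> `|F x| <= M.
Proof.
move=> cF.
have cF' : {within box D, continuous (F : 'rV[R]_d -> R^o)}.
  exact: seq_within_continuous.
have [M [_ HM]] := compact_bounded (continuous_compact cF' compact_box).
(* [compact_bounded] provides as bounds the reals strictly above [M], hence the [+ 1]. *)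
exists (M + 1) => x Dx; apply: (HM (M + 1)); first by rewrite ltrDl.
by exists x.
Qed.

Lemma paths_seq_continuous w : seq_continuous_on (box D) (fun x => Z x w).
Proof.
move=> x_ x Dx_ Dx xx.
have cw : {within box D, continuous (fun x => const_mx (Z x w) : 'rV[R]_1)}.
  exact: hpaths.
have cx := within_continuous_seq cw Dx_ Dx xx.
have ZE y : Z y w = (const_mx (Z y w) : 'rV[R]_1) 0 0 by rewrite mxE.
have -> : (fun n => Z (x_ n) w) =
    (fun n => (const_mx (Z (x_ n) w) : 'rV[R]_1) 0 0).
  by apply/funext => n; exact: ZE.
rewrite [X in _ --> X]ZE.
exact: (continuous_cvg _ (@coord_continuous R 1 1 0 0 _) cx).
Qed.

Let mbm u : measurable (box_minus D u).
Proof. by apply: measurable_box_minus => i; exact: compact_measurable. Qed.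

Let mmc u x i : measurable_fun setT (fun z => merge_coord u x z 0 i).
Proof. exact: measurable_merge_coord. Qed.

Let bmc u x : box D x ->
  forall z, box_minus D u z -> box D (merge_coord u x z).
Proof. by move=> Dx z; exact: box_merge_coord. Qed.

Definition marginal u x (w : T) : R :=
  \int[nu_minus nu u]_(z in box_minus D u) Z (merge_coord u x z) w.

Lemma marginal_approximates x0 u x : box D x0 -> box D x ->
  approximates (box D) Z (riemann_sum (box D) x0 (nu_minus nu u)
    (box_minus D u) (merge_coord u x)) (marginal u x).
Proof.
move=> Dx0 Dx; split=> [n q|w]; first exact: riemann_sum_in.
have cw := @paths_seq_continuous w.
have [M ZM] := seq_continuous_bounded cw.
exact: (riemann_sum_cvg (mu := nu_minus nu u) Dx0 (@mbm u) (@mmc u x) (bmc Dx) cw ZM).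
Qed.

(** The diagonal of [k] is sequentially continuous on a compact box, hence bounded, and it dominates
    the other values. *)
Lemma covariance_bounded : exists M, forall x y, box D x -> box D y ->
  `|k x y| <= M.
Proof.
have [M kM] : exists M, forall x, box D x -> `|k x x| <= M.
  apply: (@seq_continuous_bounded (fun x => k x x)) => x_ x Dx_ Dx xx.
  exact: (covariance_seq_continuous hgauss hcentred hcov paths_seq_continuous).
exists (M + M) => x y Dx Dy.
apply: (le_trans (normr_covariance_le hgauss hcentred hcov Dx Dy)).
apply: lerD; exact: le_trans (ler_norm _) (kM _ _).
Qed.

(** The mixed moments of the Riemann sums of both marginals tend to the left-hand side by
    [approximates_mixed_moment]. By bilinearity they are double Riemann sums of [k], which tend to
    the right-hand side. *)
Lemma mixed_moment_marginal u v x y : box D x -> box D y ->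
  mixed_moment P (marginal u x) (marginal v y) =
  (\int[(nu_minus nu u \x nu_minus nu v)%E]_(z in box_minus D u `*` box_minus D v)
    k (merge_coord u x z.1) (merge_coord v y z.2))%R.
Proof.
move=> Dx Dy; have [M kM] := covariance_bounded.
(* The point [x] of the box is the default sample point in both families, so that [riemann_sum2_cvg]
   applies to the pair. *)
have ax := @marginal_approximates x u x Dx Dx.
have ay := @marginal_approximates x v y Dx Dy.
have := approximates_mixed_moment hgauss hcentred ax ay.
have -> : (fun n => mixed_moment P
    (combination Z (riemann_sum (box D) x (nu_minus nu u) (box_minus D u)
      (merge_coord u x) n))
    (combination Z (riemann_sum (box D) x (nu_minus nu v) (box_minus D v)
      (merge_coord v y) n))) =
  (fun n => \sum_(q <- riemann_sum (box D) x (nu_minus nu u) (box_minus D u)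
      (merge_coord u x) n)
    \sum_(r <- riemann_sum (box D) x (nu_minus nu v) (box_minus D v)
      (merge_coord v y) n) q.1 * r.1 * k q.2 r.2).
  apply/funext => n.
  by apply: (mixed_moment_combination hgauss hcentred hcov);
    [exact: ax.1|exact: ay.1].
move=> /cvg_unique; apply => //.
apply: (riemann_sum2_cvg Dx (mu1 := nu_minus nu u) (mu2 := nu_minus nu v)
  (@mbm u) (@mbm v) (@mmc u x) (@mmc v y) (bmc Dx) (bmc Dy) _ kM).
exact: (covariance_seq_continuous hgauss hcentred hcov paths_seq_continuous).
Qed.

Lemma marginal_approximable u x : box D x ->
  approximable (box D) Z (marginal u x).
Proof. by move=> Dx; eexists; exact: (marginal_approximates u Dx Dx). Qed.

Lemma T_op_approximable u x : box D x ->
  approximable (box D) Z (fun w => T_op D nu u (fun x' => Z x' w) x).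
Proof.
move=> Dx; apply: (@approximable_sum _ _ _ _ _ _ _ _ _
  (fun u' : {set 'I_d} => (-1) ^+ (#|u| - #|u'|)) (fun u' => marginal u' x)).
by move=> u' _; exact: marginal_approximable.
Qed.

Lemma mixed_moment_T_op u v x y : box D x -> box D y ->
  mixed_moment P (fun w => T_op D nu u (fun x' => Z x' w) x)
    (fun w => T_op D nu v (fun x' => Z x' w) y) = T_op2 D nu u v k x y.
Proof.
move=> Dx Dy.
rewrite (mixed_moment_suml hgauss hcentred _
  (fun u' : {set 'I_d} => (-1) ^+ (#|u| - #|u'|)) (X := fun u' => marginal u' x));
  last 2 first.
- by move=> u' _; exact: marginal_approximable.
- exact: T_op_approximable.
apply: eq_bigr => u' uu'; rewrite mixed_momentC.
rewrite (mixed_moment_suml hgauss hcentred _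
  (fun v' : {set 'I_d} => (-1) ^+ (#|v| - #|v'|)) (X := fun v' => marginal v' y));
  last 2 first.
- by move=> v' _; exact: marginal_approximable.
- exact: marginal_approximable.
rewrite mulr_sumr; apply: eq_bigr => v' vv'.
(* The exponents are truncated differences of naturals; they agree because #|u'| <= #|u| and #|v'|
   <= #|v|. *)
rewrite mixed_momentC mixed_moment_marginal// mulrA -exprD; congr (_ ^+ _ * _).
have := subset_leq_card uu'; have := subset_leq_card vv'; lia.
Qed.

(** For a fixed path, bounded convergence applies to each partial integral: the path is bounded on
    the box, and [merge_coord] is continuous in the point whose coordinates are kept. *)
Lemma T_op_seq_continuous u w :
  seq_continuous_on (box D) (T_op D nu u (fun x' => Z x' w)).
Proof.
move=> x_ x Dx_ Dx xx; rewrite /T_op.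
apply: cvg_big => [|u' _]; first exact: add_continuous.
apply: cvgM; first exact: cvg_cst.
have cw := @paths_seq_continuous w.
have [M ZM] := seq_continuous_bounded cw.
apply: (@bounded_cvg_Rintegral _ _ _ (nu_minus nu u') _ _ _ M (@mbm u')).
- move=> n; exact: (measurable_seq_continuous_comp Dx (@mbm u') (@mmc u' (x_ n))
    (bmc (Dx_ n)) cw).
- move=> z Dz; apply: cw.
  + by move=> n; exact: bmc.
  + exact: bmc.
  + exact: cvg_merge_coord.
- by move=> n z Dz; apply: ZM; exact: bmc.
Qed.

End T_op_field.

Theorem theorem2 (R : realType) (d : nat) (hd : (0 < d)%N)
  (D : 'I_d -> set R) (hD : forall i, compact (D i))
  (nu : 'I_d -> probability R R) (hnu : forall i, nu i (D i) = 1%E)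
  (dT : measure_display) (T : measurableType dT) (P : probability T R)
  (Z : 'rV[R]_d -> T -> R) (k : 'rV[R]_d -> 'rV[R]_d -> R)
  (hgauss : gaussian_field P (box D) (fun x w => const_mx (Z x w) : 'rV[R]_1))
  (hcentred : centred_field P (box D) (fun x w => const_mx (Z x w) : 'rV[R]_1))
  (hcov : forall x y, box D x -> box D y ->
     covariance P (Z x) (Z y) = (k x y)%:E)
  (hpaths : continuous_paths (box D) (fun x w => const_mx (Z x w) : 'rV[R]_1)) :
  let Zu (u : {set 'I_d}) (x : 'rV[R]_d) (w : T) : R :=
    T_op D nu u (fun x' => Z x' w) x in
  let W (x : 'rV[R]_d) (w : T) : 'rV[R]_(#|{: {set 'I_d}}|) :=
    \row_j Zu (enum_val j) x w in
  [/\ gaussian_field P (box D) W,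
      centred_field P (box D) W,
      continuous_paths (box D) W &
      forall (u v : {set 'I_d}) (x y : 'rV[R]_d), box D x -> box D y ->
        covariance P (Zu u x) (Zu v y) = (T_op2 D nu u v k x y)%:E].
Proof.
move=> Zu W.
have app u x : box D x -> approximable (box D) Z (Zu u x).
  exact: T_op_approximable.
have nZu u x : box D x -> centred_normal P (Zu u x).
  by move=> /(app u)/(approximable_normal hgauss hcentred).
have E0 u x : box D x -> 'E_P[Zu u x]%E = 0%E.
  by move=> /(nZu u)/centred_normal_integral; rewrite unlock.
have WE x w j : W x w 0 j = Zu (enum_val j) x w by rewrite mxE.
split.
- move=> n x _ Dx; split=> [[i j]/=|a].
    by under eq_fun do rewrite WE; exact: (nZu _ _ (Dx i)).1.
  under eq_fun do under eq_bigr do rewrite WE.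
  (* A linear combination of the components is again a pointwise limit of combinations of [Z], so
     joint normality reduces to the one-dimensional statement. *)
  have [mY [s s0 Ys]] : centred_normal P (fun w =>
      \sum_(ij : 'I_n * 'I_#|{: {set 'I_d}}|)
        a ij * Zu (enum_val ij.2) (x ij.1) w).
    apply: (approximable_normal hgauss hcentred).
    apply: (@approximable_sum _ _ _ _ _ _ _ _ _ a
      (fun ij => Zu (enum_val ij.2) (x ij.1))) => ij _.
    exact: app.
  by split=> //; exists 0, s.
- move=> x Dx j; rewrite -[RHS](E0 (enum_val j) x Dx); congr ('E_P[_])%E.
  by apply/funext => w; rewrite WE.
(* Continuity of the vector-valued paths is checked along sequences, one component at a time. *)
- move=> w; apply: seq_within_continuous => x_ x Dx_ Dx xx.
  apply: cvg_row => j; under eq_fun do rewrite WE; rewrite WE.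
  have := T_op_seq_continuous hD (nu := nu) hpaths (u := enum_val j) (w := w) Dx_ Dx xx.
  exact.
- move=> u v x y Dx Dy; rewrite centred_covariance ?E0//.
  rewrite mixed_momentE; [|exact: nZu|exact: nZu].
  by rewrite (mixed_moment_T_op hD _ hgauss hcentred hcov hpaths).
Qed.
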